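(* Let $\Gamma$ be a discrete group, let $c_0\Gamma \subset I \subset \ell^\infty\Gamma$ be a $\Gamma\times\Gamma$-invariant proper closed ideal, and let $\mathbb X \subset \mathbb B(\ell^2\Gamma)$ be a boundary piece for $L\Gamma$. Let $I_{\mathbb X} \subset \ell^\infty\Gamma$ be the closed ideal generated by $E_{\ell^\infty\Gamma}(\mathbb X)$, where $E_{\ell^\infty\Gamma}: \mathbb B(\ell^2\Gamma) \to \ell^\infty\Gamma$ is the canonical conditional expectation (restriction to the diagonal), and let $\mathbb X_I = \overline{I\,\mathbb B(\ell^2\Gamma)\,I}^{\|\cdot\|}$ denote the $L\Gamma$-boundary piece generated by $I$. Then: (1) If $L\Gamma$ is properly proximal relative to $\mathbb X$, then $\Gamma$ is properly proximal relative to $I_{\mathbb X}$. (2) $\Gamma$ is properly proximal relative to $I$ if and only if $L\Gamma$ is properly proximal relative to $\mathbb X_I$.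
   Context: $\ell^\infty\Gamma \subset \mathbb B(\ell^2\Gamma)$ acts by multiplication operators. $L_t, R_t$ denote left and right translation on $\ell^\infty\Gamma$; $\Gamma\times\Gamma$ acts on $\ell^\infty\Gamma$ by left and right translations. For a $\Gamma\times\Gamma$-invariant closed ideal $I \supset c_0\Gamma$ put $\mathbb S_I(\Gamma) = \{ f \in \ell^\infty\Gamma \mid f - R_t f \in I \text{ for all } t\in\Gamma\}$. $\Gamma$ is properly proximal relative to $I$ if there is no state on $\mathbb S_I(\Gamma)$ invariant under all $L_t$. Let $(M,\tau)$ be a tracial von Neumann algebra (faithful normal tracial state), $M\subset L^2M\subset L^1M$ the natural inclusions, $J\hat x=\widehat{x^*}$ the conjugation on $L^2M$ (for $M = L\Gamma$, $L^2M = \ell^2\Gamma$). A boundary piece for $M$ is a non-zero hereditary $C^*$-subalgebra $\mathbb X \subset \mathbb B(L^2M)$ such that, with $M(\mathbb X)\subset \mathbb B(L^2M)$ its multiplier algebra, $M(\mathbb X)\cap M$ and $M(\mathbb X)\cap JMJ$ are ultraweakly dense in $M$ and $JMJ$ respectively; it is always assumed $\mathbb X\neq\{0\}$, so that $\mathbb K(L^2M)\subset \mathbb X$. For $T\in\mathbb B(L^2M)$ put $\|T\|_{\infty,1} = \sup\{\|T\hat x\|_1 : x\in M,\ \|x\|\le 1\}$. Let $\mathbb K_{\mathbb X}^{\infty,1}(M)$ be the $\|\cdot\|_{\infty,1}$-closure of $\mathbb X$ in $\mathbb B(L^2M)$ and $\mathbb S_{\mathbb X}(M) = \{T \in\mathbb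 B(L^2M) \mid [T,JxJ]\in \mathbb K_{\mathbb X}^{\infty,1}(M)\ \forall x\in M\}$, an operator system containing $M$ and an $M$-bimodule. $M$ is properly proximal relative to $\mathbb X$ if there is no state $\varphi$ on $\mathbb S_{\mathbb X}(M)$ that is $M$-central ($\varphi(xT)=\varphi(Tx)$ for $x\in M$) and such that $\varphi_{|M}$ is normal. *)

(* Defs.v *)
From HB Require Import structures.
From mathcomp Require Import all_boot all_order all_algebra.
From mathcomp Require Import complex.
From mathcomp Require Import all_classical all_reals all_analysis.
From mathcomp Require Import ring lra.

Set Implicit Arguments.
Unset Strict Implicit.
Unset Printing Implicit Defensive.

Import Order.TTheory GRing.Theory Num.Theory.
Import numFieldNormedType.Exports.
Local Open Scope classical_set_scope.
Local Open Scope complex_scope.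
Local Open Scope ring_scope.

Section Scalars.
Variables (R : realType) (T : choiceType).

(* the modulus as an element of R; in MathComp `|z| lives in R[i] *)
Definition cabs (z : R[i]) : R := Normc.normc z.

Lemma cabs_ge0 z : 0 <= cabs z.
Proof. by case: z => a b; exact: sqrtr_ge0. Qed.

Lemma cabs0 : cabs 0 = 0. Proof. exact: Normc.normc0. Qed.

Lemma cabs1 : cabs 1 = 1. Proof. exact: Normc.normc1. Qed.

Lemma cabsM z w : cabs (z * w) = cabs z * cabs w.
Proof. exact: Normc.normcM. Qed.

Lemma ler_cabsD z w : cabs (z + w) <= cabs z + cabs w.
Proof. exact: le_normcD. Qed.

Lemma cabsJ z : cabs z^*%C = cabs z.
Proof. by case: z => a b; rewrite /cabs /= sqrrN. Qed.

(* unordered sums; meaningful for absolutely summable families *)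
Definition rsum (f : T -> R) : R :=
  fine (\esum_(t in [set: T]) (EFin \o f)^\+%E t -
        \esum_(t in [set: T]) (EFin \o f)^\-%E t)%E.

Definition csum (f : T -> R[i]) : R[i] :=
  rsum (fun t => complex.Re (f t)) +i* rsum (fun t => complex.Im (f t)).

End Scalars.

Section Ell2.
Variables (R : realType) (T : choiceType).
Implicit Types f g : T -> R[i].

Definition sqsum f : \bar R :=
  (\esum_(t in [set: T]) ((cabs (f t)) ^+ 2)%:E)%E.

Definition sqsummable : pred (T -> R[i]) := fun f => (sqsum f < +oo)%E.

Lemma sqsum_ge0 f : (0 <= sqsum f)%E.
Proof. by apply: esum_ge0 => t _; rewrite lee_fin sqr_ge0. Qed.

Lemma le_sqsum f g (c : R) : 0 <= c ->
  (forall t, cabs (f t) <= c * cabs (g t)) ->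
  (sqsum f <= (c ^+ 2)%:E * sqsum g)%E.
Proof.
move=> c0 fg; apply: ge_ereal_sup => _ [F [finF _] <-].
have le1 : (\sum_(t \in F) ((cabs (f t)) ^+ 2)%:E
    <= (c ^+ 2)%:E * \sum_(t \in F) ((cabs (g t)) ^+ 2)%:E)%E.
  rewrite ge0_mule_fsumr; last by move=> t; rewrite lee_fin sqr_ge0.
  apply: lee_fsum => // t _; rewrite -EFinM lee_fin -exprMn.
  by apply: lerXn2r; rewrite ?nnegrE ?mulr_ge0 ?cabs_ge0.
apply: (le_trans le1); apply: lee_wpmul2l; first by rewrite lee_fin sqr_ge0.
by apply: ereal_sup_ubound; exists F.
Qed.

Lemma sqsumD f g : (sqsum (f + g)%R <= 2%:E * (sqsum f + sqsum g))%E.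
Proof.
rewrite /sqsum -esumD; try by move=> t _; rewrite lee_fin sqr_ge0.
apply: ge_ereal_sup => _ [F [finF _] <-].
have le1 : (\sum_(t \in F) ((cabs ((f + g)%R t)) ^+ 2)%:E
    <= 2%:E * \sum_(t \in F) ((cabs (f t) ^+ 2)%:E + (cabs (g t) ^+ 2)%:E))%E.
  rewrite ge0_mule_fsumr; last by move=> t; rewrite adde_ge0 ?lee_fin ?sqr_ge0.
  apply: lee_fsum => // t _; rewrite -EFinD -EFinM lee_fin.
  have h := ler_cabsD (f t) (g t).
  have h1 : cabs ((f + g) t) ^+ 2 <= (cabs (f t) + cabs (g t)) ^+ 2.
    by apply: lerXn2r; rewrite ?nnegrE ?addr_ge0 ?cabs_ge0.
  apply: (le_trans h1); rewrite -subr_ge0.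
  set a := cabs (f t); set b := cabs (g t).
  have -> : 2 * (a ^+ 2 + b ^+ 2) - (a + b) ^+ 2 = (a - b) ^+ 2 by ring.
  exact: sqr_ge0.
apply: (le_trans le1); apply: lee_wpmul2l; first by rewrite lee_fin.
by apply: ereal_sup_ubound; exists F.
Qed.

Lemma sqsummable_submod : subsemimod_closed sqsummable.
Proof.
split; first split.
- rewrite unfold_in /sqsummable /sqsum esum1 ?ltry// => t _.
  by rewrite [cabs _]cabs0 expr0n.
- move=> f g; rewrite !unfold_in /sqsummable => f1 g1.
  apply: (le_lt_trans (sqsumD f g)).
  by rewrite lte_mul_pinfty ?lte_add_pinfty// ?lee_fin.
- move=> a f; rewrite !unfold_in /sqsummable => f1.
  apply: (@le_lt_trans _ _ ((cabs a ^+ 2)%:E * sqsum f)%E).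
    by apply: le_sqsum => [|t]; rewrite ?cabs_ge0// [cabs _]cabsM.
  by rewrite lte_mul_pinfty// ?lee_fin ?sqr_ge0.
Qed.

HB.instance Definition _ := GRing.isSubmodClosed.Build R[i] (T -> R[i])
  sqsummable sqsummable_submod.

Record ell2 := Ell2 { ell2_fun :> T -> R[i]; ell2P : sqsummable ell2_fun }.

HB.instance Definition _ := [isSub for ell2_fun].
HB.instance Definition _ := [Choice of ell2 by <:].
HB.instance Definition _ := [SubChoice_isSubLmodule of ell2 by <:].

Definition l2norm (v : ell2) : R := Num.sqrt (fine (sqsum v)).

Definition dot (v w : ell2) : R[i] := csum (fun t => v t * (w t)^*%C).

Lemma ell2_eqP (v w : ell2) : (forall t, v t = w t) -> v = w.
Proof. by move=> vw; apply/val_inj/funext. Qed.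

Lemma sqsum_fin (v : ell2) : sqsum v \is a fin_num.
Proof. by rewrite ge0_fin_numE ?sqsum_ge0//; exact: ell2P. Qed.

Lemma l2norm_sqr (v : ell2) : (l2norm v ^+ 2)%:E = sqsum v.
Proof.
by rewrite sqr_sqrtr ?fine_ge0 ?sqsum_ge0// fineK// sqsum_fin.
Qed.

Lemma l2norm_ge0 (v : ell2) : 0 <= l2norm v.
Proof. exact: sqrtr_ge0. Qed.

Lemma l2norm_le (v w : ell2) (c : R) : 0 <= c ->
  (sqsum v <= (c ^+ 2)%:E * sqsum w)%E -> l2norm v <= c * l2norm w.
Proof.
move=> c0; rewrite -!l2norm_sqr -EFinM lee_fin -exprMn.
by rewrite ler_pXn2r// ?nnegrE ?mulr_ge0 ?l2norm_ge0.
Qed.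

Lemma l2normD_le2 (v w : ell2) : l2norm (v + w) <= 2 * (l2norm v + l2norm w).
Proof.
rewrite -(@ler_pXn2r _ 2)// ?nnegrE ?mulr_ge0 ?addr_ge0 ?l2norm_ge0//.
rewrite -lee_fin l2norm_sqr; apply: (le_trans (sqsumD v w)).
rewrite -!l2norm_sqr -EFinD -EFinM lee_fin.
have := l2norm_ge0 v; have := l2norm_ge0 w; nra.
Qed.

Lemma cabs_le_l2norm (v : ell2) t : cabs (v t) <= l2norm v.
Proof.
rewrite -(@ler_pXn2r _ 2)// ?nnegrE ?cabs_ge0 ?l2norm_ge0//.
rewrite -lee_fin l2norm_sqr; apply: ereal_sup_ubound.
by exists [set t]; [split | rewrite fsbig_set1].
Qed.

Definition delta_fun (t : T) : T -> R[i] := fun s => (s == t)%:R.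

Lemma sqsum_delta t : sqsum (delta_fun t) = 1%E.
Proof.
rewrite /sqsum (esumID [set t])/=; last by move=> s _; rewrite lee_fin sqr_ge0.
rewrite setTI esum_set1 ?lee_fin ?sqr_ge0//.
rewrite /delta_fun eqxx cabs1 expr1n esum1 ?adde0// => s [_ /= /eqP/negPf ->].
by rewrite cabs0 expr0n.
Qed.

Lemma delta_subproof t : sqsummable (delta_fun t).
Proof. by rewrite /sqsummable sqsum_delta ltry. Qed.

Definition delta (t : T) : ell2 := Ell2 (delta_subproof t).

Lemma l2norm_delta t : l2norm (delta t) = 1.
Proof. by rewrite /l2norm sqsum_delta sqrtr1. Qed.

End Ell2.

Arguments ell2 : clear implicits.

Section Dot.
Variables (R : realType) (T : choiceType).

Lemma rsum_single (t : T) (f : T -> R) : (forall s, s != t -> f s = 0) ->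
  rsum f = f t.
Proof.
move=> ft; have E (g : T -> \bar R) : (forall s, 0 <= g s)%E ->
    (forall s, s != t -> g s = 0)%E -> (\esum_(s in [set: T]) g s = g t)%E.
  move=> g0 gt; rewrite (esumID [set t])//= setTI esum_set1//.
  by rewrite esum1 ?adde0// => s [_ /= /eqP/gt].
rewrite /rsum !E //=.
- by have /(congr1 (fun h => h t)) := funeposneg (EFin \o f); rewrite /= => <-.
- by move=> s /ft fs; rewrite funenegE /= fs oppr0 maxxx.
- by move=> s /ft fs; rewrite funeposE /= fs maxxx.
Qed.

Lemma dot_delta (v : ell2 R T) t : dot v (delta R t) = v t.
Proof.
rewrite /dot /csum !(rsum_single (t := t)) /= /delta_fun.
- by rewrite eqxx [X in _ * X]conjc1 mulr1; case: (v t).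
- by move=> s /negPf ->; rewrite /= [X in _ * X]conjc0 mulr0.
- by move=> s /negPf ->; rewrite /= [X in _ * X]conjc0 mulr0.
Qed.

Lemma delta_dot (v : ell2 R T) t : dot (delta R t) v = (v t)^*%C.
Proof.
rewrite /dot /csum !(rsum_single (t := t)) /= /delta_fun.
- by rewrite eqxx mul1r; case: (v t).
- by move=> s /negPf ->; rewrite /= mul0r.
- by move=> s /negPf ->; rewrite /= mul0r.
Qed.
End Dot.

Section Linf.
Variables (R : realType) (T : choiceType).

Definition bounded_fct : pred (T -> R[i]) :=
  fun f => `[< exists c : R, forall t, cabs (f t) <= c >].

Lemma bounded_fct_submod : subsemimod_closed bounded_fct.
Proof.
split; first split.
- by apply/asboolP; exists 0 => t; rewrite [cabs _]cabs0.
- move=> f g /asboolP[c fc] /asboolP[d gd]; apply/asboolP; exists (c + d) => t.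
  by rewrite (le_trans (ler_cabsD _ _))// lerD.
- move=> a f /asboolP[c fc]; apply/asboolP; exists (cabs a * c) => t.
  by rewrite [cabs _]cabsM ler_wpM2l// cabs_ge0.
Qed.

Lemma bounded_fct_mul : mulr_closed bounded_fct.
Proof.
split; first by apply/asboolP; exists 1 => t; rewrite [cabs _]cabs1.
move=> f g /asboolP[c fc] /asboolP[d gd]; apply/asboolP; exists (c * d) => t.
by rewrite [cabs _]cabsM ler_pM ?cabs_ge0.
Qed.

HB.instance Definition _ := GRing.isSubmodClosed.Build R[i] (T -> R[i])
  bounded_fct bounded_fct_submod.
HB.instance Definition _ := GRing.isMulClosed.Build (T -> R[i])
  bounded_fct bounded_fct_mul.

Record linf := Linf { linf_fun :> T -> R[i]; linfP : bounded_fct linf_fun }.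

HB.instance Definition _ := [isSub for linf_fun].
HB.instance Definition _ := [Choice of linf by <:].
HB.instance Definition _ := [SubChoice_isSubLmodule of linf by <:].
HB.instance Definition _ := GRing.SubZmodule_isSubPzRing.Build _ _ linf
  (GRing.subringClosedP _).
HB.instance Definition _ := GRing.SubPzRing_isSubComPzRing.Build _ _ linf.

Definition supnorm (f : linf) : R := sup (range (fun t => cabs (f t))).

End Linf.

Arguments linf : clear implicits.

Section Operators.
Variables (R : realType) (T : choiceType).
Local Notation H := (ell2 R T).

Definition bounded_linear : pred (H -> H) := fun A =>
  `[< (forall a v w, A (a *: v + w) = a *: A v + A w) /\
      exists c : R, forall v, l2norm (A v) <= c * l2norm v >].

Lemma bounded_linear_submod : subsemimod_closed bounded_linear.
Proof.
split; first split.
- apply/asboolP; split=> [a v w|]; first by rewrite /= scaler0 addr0.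
  exists 0 => v; rewrite mul0r; apply: le_trans (_ : 0 * l2norm v <= 0).
    by apply: l2norm_le => //; apply: le_sqsum => // t; rewrite [cabs _]cabs0 mul0r.
  by rewrite mul0r.
- move=> A B /asboolP[lA [c Ac]] /asboolP[lB [d Bd]]; apply/asboolP; split.
    move=> a v w; rewrite -[LHS]/(A (a *: v + w) + B (a *: v + w)) lA lB.
    by rewrite -[RHS]/(a *: (A v + B v) + (A w + B w)) scalerDr addrACA.
  exists (2 * (c + d)) => v; apply: (le_trans (l2normD_le2 _ _)).
  by rewrite -mulrA ler_pM2l// mulrDl lerD.
- move=> b A /asboolP[lA [c Ac]]; apply/asboolP; split.
    move=> a v w; rewrite -[LHS]/(b *: A (a *: v + w)) lA.
    by rewrite -[RHS]/(a *: (b *: A v) + b *: A w) scalerDr !scalerA mulrC.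
  exists (cabs b * c) => v; rewrite -mulrA.
  apply: le_trans (_ : cabs b * l2norm (A v) <= _).
    apply: l2norm_le; rewrite ?cabs_ge0//.
    by apply: le_sqsum; rewrite ?cabs_ge0// => t; rewrite [cabs _]cabsM.
  by rewrite ler_wpM2l ?cabs_ge0.
Qed.

HB.instance Definition _ := GRing.isSubmodClosed.Build R[i] (H -> H)
  bounded_linear bounded_linear_submod.

(* B(ell2 T) *)
Record bop := Bop { bop_fun :> H -> H; bopP : bounded_linear bop_fun }.

HB.instance Definition _ := [isSub for bop_fun].
HB.instance Definition _ := [Choice of bop by <:].
HB.instance Definition _ := [SubChoice_isSubLmodule of bop by <:].

Lemma bop_linear (A : bop) a v w : A (a *: v + w) = a *: A v + A w.
Proof. by case: A => A /= /asboolP[]. Qed.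

Lemma bop_bounded (A : bop) :
  exists2 c : R, 0 <= c & forall v, l2norm (A v) <= c * l2norm v.
Proof.
case: A => A /= /asboolP[_ [c Ac]]; exists `|c| => // v.
by apply: (le_trans (Ac v)); rewrite ler_wpM2r ?l2norm_ge0// ler_norm.
Qed.

Lemma bop_eqP (A B : bop) : (forall v, A v = B v) -> A = B.
Proof. by move=> AB; apply/val_inj/funext. Qed.

Lemma bop_one_subproof : bounded_linear (@idfun H).
Proof. by apply/asboolP; split=> //; exists 1 => v; rewrite mul1r. Qed.

Lemma bop_mul_subproof (A B : bop) : bounded_linear (A \o B).
Proof.
apply/asboolP; split=> [a v w|]; first by rewrite /= !bop_linear.
have [c c0 Ac] := bop_bounded A; have [d d0 Bd] := bop_bounded B.
exists (c * d) => v; rewrite -mulrA; apply: (le_trans (Ac _)).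
by rewrite ler_wpM2l.
Qed.

Definition bop_one : bop := Bop bop_one_subproof.
Definition bop_mul (A B : bop) : bop := Bop (bop_mul_subproof A B).

Lemma bopD (A : bop) v w : A (v + w) = A v + A w.
Proof. by rewrite -[v]scale1r bop_linear !scale1r. Qed.

Lemma bop_mulA : associative bop_mul.
Proof. by move=> A B C; apply: bop_eqP. Qed.
Lemma bop_mul1l : left_id bop_one bop_mul.
Proof. by move=> A; apply: bop_eqP. Qed.
Lemma bop_mul1r : right_id bop_one bop_mul.
Proof. by move=> A; apply: bop_eqP. Qed.
Lemma bop_mulDl : left_distributive bop_mul +%R.
Proof. by move=> A B C; apply: bop_eqP. Qed.
Lemma bop_mulDr : right_distributive bop_mul +%R.
Proof. by move=> A B C; apply: bop_eqP => v; rewrite /= bopD. Qed.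

HB.instance Definition _ := GRing.Zmodule_isPzRing.Build bop
  bop_mulA bop_mul1l bop_mul1r bop_mulDl bop_mulDr.

Definition opnorm (A : bop) : R :=
  sup [set l2norm (A v) | v in [set v | l2norm v <= 1]].

Definition adjoint_of (A B : bop) : Prop :=
  forall v w, dot (A v) w = dot v (B w).

Definition positive_bop : set bop := [set A | forall v, 0 <= dot (A v) v].

Definition commutator (A B : bop) : bop := A * B - B * A.

Definition commutant (S : set bop) : set bop :=
  [set A | forall B, S B -> A * B = B * A].

(* The ultraweak topology: the coarsest one making A |-> sum_n <A v_n, w_n>
   continuous for all square-summable sequences of vectors v and w. *)
Definition sqsummable_seq (v : nat -> H) : Prop :=
  (\esum_(n in [set: nat]) ((l2norm (v n)) ^+ 2)%:E < +oo)%E.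

Definition uw_index : Type :=
  {p : (nat -> H) * (nat -> H) | sqsummable_seq p.1 /\ sqsummable_seq p.2}.

Definition uw_eval (A : bop) : prod_topology (fun _ : uw_index => R[i]^o) :=
  fun p => csum (fun n => dot (A ((sval p).1 n)) ((sval p).2 n)).

Definition ultraweak : Type := initial_topology uw_eval.

HB.instance Definition _ :=
  Topological.copy ultraweak (initial_topology uw_eval).

Definition ultraweakly_dense (A B : set bop) : Prop :=
  B `<=` closure (A : set ultraweak).

Lemma mulop_fun_subproof (f : linf R T) (v : H) :
  sqsummable (fun t => f t * v t).
Proof.
case: f => f /= /asboolP[c fc]; rewrite /sqsummable.
apply: (@le_lt_trans _ _ ((`|c| ^+ 2)%:E * sqsum v)%E).
  apply: le_sqsum => // t; rewrite cabsM ler_wpM2r ?cabs_ge0//.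
  by rewrite (le_trans (fc t))// ler_norm.
by rewrite lte_mul_pinfty// ?lee_fin ?sqr_ge0//; exact: ell2P.
Qed.

Definition mulop_fun (f : linf R T) (v : H) : H := Ell2 (mulop_fun_subproof f v).

Lemma mulop_subproof f : bounded_linear (mulop_fun f).
Proof.
apply/asboolP; split.
  move=> a v w; apply: ell2_eqP => t.
  by rewrite -[LHS]/(f t * (a * v t + w t)) mulrDr mulrCA.
have /asboolP[c fc] := linfP f; exists `|c| => v; apply: l2norm_le => //.
apply: le_sqsum => // t; rewrite cabsM ler_wpM2r ?cabs_ge0//.
by rewrite (le_trans (fc t))// ler_norm.
Qed.

Definition mulop (f : linf R T) : bop := Bop (mulop_subproof f).

Lemma diag_subproof (A : bop) : bounded_fct (fun t => A (delta R t) t).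
Proof.
have [c c0 Ac] := bop_bounded A; apply/asboolP; exists c => t.
by rewrite (le_trans (cabs_le_l2norm _ _))// (le_trans (Ac _))// l2norm_delta mulr1.
Qed.

(* the conditional expectation of B(ell2 T) onto the diagonal *)
Definition diag (A : bop) : linf R T := Linf (diag_subproof A).

End Operators.

Arguments bop : clear implicits.
Arguments ultraweak : clear implicits.

Section Closures.
Variables (R : realType) (V : lmodType R[i]).

Definition closure_wrt (N : V -> R) (S : set V) : set V :=
  [set x | forall e : R, 0 < e -> exists2 y, S y & N (x - y) < e].

Definition state_on (S : set V) (one : V) (pos : set V) (phi : V -> R[i]) :=
  [/\ forall a x y, S x -> S y -> phi (a *: x + y) = a * phi x + phi y,
      phi one = 1 &
      forall x, S x -> pos x -> 0 <= phi x].

End Closures.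

(* M acts on H = L^2 M; xi is the trace vector, so that x^ = x xi for x in M,
   tau x = <x xi, xi>, and J is the conjugation x^ |-> (x^* )^. *)
Section BoundaryPieces.
Variables (R : realType) (T : choiceType).
Local Notation H := (ell2 R T).
Local Notation B := (bop R T).
Variables (M : set B) (xi : H) (J : H -> H).

Definition opposite : set B :=
  [set A | exists2 x, M x & forall v, A v = J (x (J v))].

Record cstar_subalgebra (X : set B) : Prop := {
  cstar0 : X 0;
  cstarD : forall A C, X A -> X C -> X (A + C);
  cstarZ : forall a A, X A -> X (a *: A);
  cstarM : forall A C, X A -> X C -> X (A * C);
  cstar_adj : forall A C, X A -> adjoint_of A C -> X C;
  cstar_closed : closure_wrt (@opnorm R T) X `<=` X }.

Definition hereditary (X : set B) : Prop :=
  forall A C, positive_bop A -> positive_bop (C - A) -> X C -> X A.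

(* X acts nondegenerately, so its multiplier algebra is its idealizer. *)
Definition multiplier (X : set B) : set B :=
  [set A | forall C, X C -> X (A * C) /\ X (C * A)].

Record boundary_piece (X : set B) : Prop := {
  bpiece_cstar : cstar_subalgebra X;
  bpiece_hereditary : hereditary X;
  bpiece_neq0 : exists2 A, X A & A <> 0;
  bpiece_denseM : ultraweakly_dense (multiplier X `&` M) M;
  bpiece_denseJMJ : ultraweakly_dense (multiplier X `&` opposite) opposite }.

(* L^1 M is the predual of M, and v in L^2 M is the functional
   x |-> tau (x v) = <x v, xi> of L^1 M. *)
Definition norm1 (v : H) : R :=
  sup [set cabs (dot (x v) xi) | x in [set x | M x /\ opnorm x <= 1]].

Definition norm_infty1 (A : B) : R :=
  sup [set norm1 (A (x xi)) | x in [set x | M x /\ opnorm x <= 1]].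

Definition K_infty1 (X : set B) : set B := closure_wrt norm_infty1 X.

Definition S_vN (X : set B) : set B :=
  [set A | forall C, opposite C -> K_infty1 X (commutator A C)].

Definition central_on (S : set B) (phi : B -> R[i]) : Prop :=
  forall x A, M x -> S A -> phi (x * A) = phi (A * x).

Definition normal (phi : B -> R[i]) : Prop :=
  {within (M : set (ultraweak R T)),
    continuous (phi : ultraweak R T -> R[i]^o)}.

Definition vN_properly_proximal (X : set B) : Prop :=
  ~ exists phi : B -> R[i],
      [/\ state_on (S_vN X) 1 (@positive_bop R T) phi,
          central_on (S_vN X) phi & normal phi].

End BoundaryPieces.

Section Groups.
Variables (R : realType) (G : groupType).
Local Notation H := (ell2 R G).
Local Notation Linfty := (linf R G).
Implicit Types (t s : G) (f : Linfty) (I : set Linfty).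

Lemma sqsum_reindex (h : G -> G) (g : G -> R[i]) :
  bijective h -> sqsum (g \o h) = sqsum g.
Proof.
move=> bh; rewrite /sqsum [RHS](@reindex_esum _ _ _ [set: G] [set: G] h)//.
by rewrite setTT_bijective.
Qed.

Lemma mulg_bij t : bijective (fun s => (t^-1 * s)%g).
Proof.
by exists (fun s => (t * s)%g) => s; rewrite mulgA ?mulgV ?mulVg mul1g.
Qed.

Lemma invg_bij : bijective (fun s : G => (s^-1)%g).
Proof. by exists (fun s => (s^-1)%g) => s; rewrite invgK. Qed.

Lemma lambda_fun_subproof t (v : H) : sqsummable (fun s => v (t^-1 * s)%g).
Proof.
by rewrite /sqsummable [sqsum _](sqsum_reindex v (mulg_bij t)); exact: ell2P.
Qed.

Definition lambda_fun t (v : H) : H := Ell2 (lambda_fun_subproof t v).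

Lemma lambda_subproof t : bounded_linear (lambda_fun t).
Proof.
apply/asboolP; split=> [a v w|]; first exact: ell2_eqP.
exists 1 => v; rewrite mul1r /l2norm.
by rewrite [sqsum (lambda_fun t v)](sqsum_reindex v (mulg_bij t)).
Qed.

(* lambda t maps delta s to delta (t * s) *)
Definition lambda t : bop R G := Bop (lambda_subproof t).

Definition group_vN : set (bop R G) := commutant (commutant (range lambda)).

Lemma conjJ_subproof (v : H) : sqsummable (fun s => (v s^-1%g)^*%C).
Proof.
have -> : sqsummable (fun s => (v s^-1%g)^*%C)
          = sqsummable (v \o (fun s : G => s^-1%g)).
  by congr (_ < _)%E; apply: eq_esum => s _ /=; rewrite cabsJ.
by rewrite /sqsummable (sqsum_reindex v invg_bij); exact: ell2P.
Qed.

Definition conjJ (v : H) : H := Ell2 (conjJ_subproof v).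

Lemma rho_fun_subproof (t : G) (v : H) : sqsummable (fun s => v (s * t)%g).
Proof.
have b : bijective (fun s => (s * t)%g).
  by exists (fun s => (s * t^-1)%g) => s; rewrite -mulgA ?mulgV ?mulVg mulg1.
by rewrite /sqsummable [sqsum _](sqsum_reindex v b); exact: ell2P.
Qed.

Definition rho_fun t (v : H) : H := Ell2 (rho_fun_subproof t v).

Lemma rho_subproof t : bounded_linear (rho_fun t).
Proof.
have b : bijective (fun s => (s * t)%g).
  by exists (fun s => (s * t^-1)%g) => s; rewrite -mulgA ?mulgV ?mulVg mulg1.
apply/asboolP; split=> [a v w|]; first exact: ell2_eqP.
by exists 1 => v; rewrite mul1r /l2norm [sqsum (rho_fun t v)](sqsum_reindex v b).
Qed.

Definition rho t : bop R G := Bop (rho_subproof t).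

(* conjJ is the conjugation x^ |-> (x^* )^ of L^2(LG) = ell2 G. *)
Lemma conjJ_hat (x y : bop R G) : group_vN x -> adjoint_of x y ->
  conjJ (x (delta R 1%g)) = y (delta R 1%g).
Proof.
move=> xL xy; apply: ell2_eqP => t.
have xr : x * rho t = rho t * x.
  apply: xL => _ [s _ <-]; apply: bop_eqP => v; apply: ell2_eqP => u /=.
  by rewrite mulgA.
have dt : rho t (delta R t) = delta R 1%g.
  apply: ell2_eqP => s /=; rewrite /delta_fun.
  by rewrite -{2}(mul1g t) (can_eq (mulgK t)).
have := xy (delta R t) (delta R 1%g); rewrite dot_delta delta_dot.
move=> /(congr1 (fun z => z^*%C)); rewrite conjcK => <- /=; congr (_^*%C).
rewrite -dt -[x (rho t _)]/((x * rho t) _) xr /=.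
by rewrite mulVg.
Qed.
Lemma Ltr_subproof t f : bounded_fct (fun s => f (t^-1 * s)%g).
Proof. by have /asboolP[c fc] := linfP f; apply/asboolP; exists c. Qed.

Lemma Rtr_subproof t f : bounded_fct (fun s => f (s * t)%g).
Proof. by have /asboolP[c fc] := linfP f; apply/asboolP; exists c. Qed.

Definition Ltr t f : Linfty := Linf (Ltr_subproof t f).
Definition Rtr t f : Linfty := Linf (Rtr_subproof t f).

Definition c_0 : set Linfty :=
  [set f | forall e : R, 0 < e -> finite_set [set t | e <= cabs (f t)]].

Record closed_ideal I : Prop := {
  ideal0 : I 0;
  idealD : forall f g, I f -> I g -> I (f + g);
  idealM : forall f g, I g -> I (f * g);
  ideal_closed : closure_wrt (@supnorm R G) I `<=` I }.

Definition translation_invariant I : Prop :=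
  forall t f, I f -> I (Ltr t f) /\ I (Rtr t f).

Definition S_group I : set Linfty := [set f | forall t, I (f - Rtr t f)].

Definition group_properly_proximal I : Prop :=
  ~ exists phi : Linfty -> R[i],
      state_on (S_group I) 1 [set f | forall t, 0 <= f t] phi /\
      forall t f, S_group I f -> phi (Ltr t f) = phi f.

Definition LG_properly_proximal (X : set (bop R G)) : Prop :=
  vN_properly_proximal group_vN (delta R 1%g) conjJ X.

Definition LG_boundary_piece (X : set (bop R G)) : Prop :=
  boundary_piece group_vN conjJ X.

Definition ideal_of_piece (X : set (bop R G)) : set Linfty :=
  smallest closed_ideal (@diag R G @` X).

(* I B(ell2 G) I is the linear span of the products *)
Definition piece_of_ideal I : set (bop R G) :=
  closure_wrt (@opnorm R G)
    [set A | exists (n : nat) (f g : 'I_n -> Linfty) (C : 'I_n -> bop R G),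
       (forall k, I (f k) /\ I (g k)) /\
       A = \sum_(k < n) mulop (f k) * C k * mulop (g k)].

End Groups.

(* Main.v *)
Require Import Defs.
From mathcomp Require Import all_boot all_order all_algebra.
From mathcomp Require Import complex.
From mathcomp Require Import all_classical all_reals all_analysis.
From mathcomp Require Import ring lra.

(** Both properties fail exactly when a certain state exists, so the theorem is
    about carrying states between functions on the group and operators.

    Restriction to the diagonal, [diag], carries operators to functions. For an
    ideal [I] and a set [X] of operators, suppose that the diagonals of all
    products of a member of [X] with translations lie in [I]; this is
    [translates_in I X]. Diagonal entries of such products are matrix entries
    between two translations applied to the trace vector, hence are bounded by
    the norm from the algebra to its predual, and the condition passes to the
    closure of [X] in that norm. Conjugating by a right translation then shows
    that [diag] maps the operator system of [X] into that of [I]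
    ([diag_S_group]). If [phi] is a state invariant under left translations,
    [phi \o diag] is a state; it restricts to the trace on the algebra, so it is
    normal there. Invariance says that it is central for the left translations,
    and it is central for the whole algebra because an element [x] of the
    algebra is approximated by combinations of translations in the norm of its
    first column [x delta1], a norm that controls the diagonals of [x * A] and
    [A * x] ([diag_central]). The result is [group_pp_of_LG_pp].

    A boundary piece [X] satisfies [translates_in] for the ideal generated by
    its diagonals ([boundary_piece_translates]): [X] absorbs its multipliers but
    not the translations, yet multipliers approximate translations
    ultraweakly. On a single vector ultraweak approximation by a subspace can be
    turned into norm approximation ([ultraweak_closure_approx], by orthogonal
    projection), and for operators in one of the two commuting algebras being
    small on the trace vector means having all columns and rows small. For the
    piece generated by an ideal [I], [translates_in I] is a direct computation,
    as [mulop f] multiplies diagonals by [f].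

    Conversely, multiplication operators carry functions to operators. The
    commutator of [mulop f] with a right translation is that translation followed
    by multiplication by [f - Rtr t f], and for [f] in the operator system of [I]
    it belongs to the piece generated by [I]; approximation on the trace vector
    extends this to the whole commutant, with the closure of the piece in the
    norm from the algebra to its predual ([mulop_lambda_S]). So a
    central state [phi] gives the state [phi \o mulop], which is invariant since
    left translation of [f] is conjugation of [mulop f] by a unitary of the
    algebra. *)

Set Implicit Arguments.
Unset Strict Implicit.
Unset Printing Implicit Defensive.

Import Order.TTheory GRing.Theory Num.Theory.
Import numFieldNormedType.Exports.
Local Open Scope classical_set_scope.
Local Open Scope complex_scope.
Local Open Scope ring_scope.

(** * Moduli of complex numbers *)

Section Modulus.
Variable R : realType.
Implicit Types (z w : R[i]) (a : R).

Lemma cabsN z : cabs (- z) = cabs z.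
Proof. by case: z => a b; rewrite /cabs /= !sqrrN. Qed.

Lemma cabs_sqr z : cabs z ^+ 2 = complex.Re z ^+ 2 + complex.Im z ^+ 2.
Proof. by case: z => a b; rewrite /cabs /= sqr_sqrtr// addr_ge0 ?sqr_ge0. Qed.

Lemma cabs_eq0 z : cabs z = 0 -> z = 0.
Proof. exact: Normc.eq0_normc. Qed.

Lemma cabsR a : cabs a%:C = `|a|.
Proof. by rewrite /cabs /= expr0n addr0 sqrtr_sqr. Qed.

Lemma ge0_cabsE z : 0 <= z -> z = (cabs z)%:C.
Proof.
case: z => a b; rewrite lecE /= => /andP[/eqP-> a0].
by rewrite expr0n addr0 sqrtr_sqr ger0_norm.
Qed.

Lemma Re_le_cabs z : `|complex.Re z| <= cabs z.
Proof.
rewrite -ler_sqr ?nnegrE ?cabs_ge0// cabs_sqr real_normK ?num_real//.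
by rewrite lerDl sqr_ge0.
Qed.

Lemma Im_le_cabs z : `|complex.Im z| <= cabs z.
Proof.
rewrite -ler_sqr ?nnegrE ?cabs_ge0// cabs_sqr real_normK ?num_real//.
by rewrite lerDr sqr_ge0.
Qed.

Lemma cabs_mulJ z : z * z^*%C = (cabs z ^+ 2)%:C.
Proof.
rewrite cabs_sqr; case: z => a b /=; apply/eqP; rewrite eq_complex /=.
by apply/andP; split; apply/eqP; ring.
Qed.

Lemma ReM z w :
  complex.Re (z * w) = complex.Re z * complex.Re w - complex.Im z * complex.Im w.
Proof. by case: z w => [a b] [c d]. Qed.

Lemma ImM z w :
  complex.Im (z * w) = complex.Re z * complex.Im w + complex.Im z * complex.Re w.
Proof. by case: z w => [a b] [c d]. Qed.

Lemma ReD z w : complex.Re (z + w) = complex.Re z + complex.Re w.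
Proof. by case: z w => [a b] [c d]. Qed.

Lemma ImD z w : complex.Im (z + w) = complex.Im z + complex.Im w.
Proof. by case: z w => [a b] [c d]. Qed.

Lemma conjD z w : (z + w)^*%C = z^*%C + w^*%C.
Proof. by case: z w => [a b] [c d]; apply/eqP; rewrite eq_complex /= opprD !eqxx. Qed.

Lemma conjM z w : (z * w)^*%C = z^*%C * w^*%C.
Proof.
case: z w => [a b] [c d]; apply/eqP; rewrite eq_complex /=.
by apply/andP; split; apply/eqP; ring.
Qed.

Lemma conjN z : (- z)^*%C = - z^*%C.
Proof. by case: z. Qed.

Lemma conjR a : (a%:C)^*%C = a%:C.
Proof. by apply/eqP; rewrite eq_complex /= oppr0 !eqxx. Qed.

End Modulus.

(** * Linearity of unordered sums *)

Section UnorderedSums.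
Variables (R : realType) (T : choiceType).
Implicit Types f g p q : T -> R.

Definition abs_summable f := summable [set: T] (EFin \o f).

(** The real-valued sum of a nonnegative summable family, through which [rsum]
    is compared with the additive and homogeneous sums in the extended reals. *)
Definition nnsum p : R := fine (\esum_(t in [set: T]) (p t)%:E).

Lemma abs_summable_le f g : (forall t, `|f t| <= g t) -> abs_summable g ->
  abs_summable f.
Proof.
move=> fg; apply: le_lt_trans; apply: le_esum => t _ /=.
by rewrite lee_fin (le_trans (fg t))// ler_norm.
Qed.

Lemma abs_summableD f g : abs_summable f -> abs_summable g ->
  abs_summable (fun t => f t + g t).
Proof. exact: summableD. Qed.

(** The inequality from left to right holds for every nonnegative constant;
    applied to the inverse of [c] it gives the other one. *)
Lemma esum_scale (c : R) p : 0 <= c -> (forall t, 0 <= p t) ->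
  (\esum_(t in [set: T]) (c * p t)%:E =
   c%:E * \esum_(t in [set: T]) (p t)%:E)%E.
Proof.
have le (d : R) q : 0 <= d -> (forall t, 0 <= q t) ->
    (\esum_(t in [set: T]) (d * q t)%:E <=
     d%:E * \esum_(t in [set: T]) (q t)%:E)%E.
  move=> d0 q0; apply: ge_ereal_sup => _ [F [finF _] <-].
  rewrite (eq_fsbigr (fun t => d%:E * (q t)%:E)%E) => [|t _]; last by rewrite EFinM.
  rewrite -ge0_mule_fsumr; last by move=> t; rewrite lee_fin.
  by apply: lee_wpmul2l => //; apply: ereal_sup_ubound; exists F.
move=> c0 p0; apply/eqP; rewrite eq_le le//=.
have [->|cn0] := eqVneq c 0.
  by rewrite mul0e esum_ge0// => t _; rewrite mul0r.
have cV : 0 <= c^-1 by rewrite invr_ge0.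
have := le _ (fun t => c * p t) cV (fun t => mulr_ge0 c0 (p0 t)).
have -> : (\esum_(t in [set: T]) (c^-1 * (c * p t))%:E =
           \esum_(t in [set: T]) (p t)%:E)%E.
  by apply: eq_esum => t _; rewrite mulKf.
move=> /(lee_wpmul2l (_ : 0 <= c%:E)%E); rewrite lee_fin => /(_ c0).
by rewrite muleA -EFinM divff// mul1e.
Qed.

Lemma abs_summable_scale (c : R) f : abs_summable f ->
  abs_summable (fun t => c * f t).
Proof.
move=> fs; rewrite /abs_summable /summable.
have -> : (\esum_(t in [set: T]) `|(c * f t)%:E| =
    `|c|%:E * \esum_(t in [set: T]) `|f t|%:E)%E.
  rewrite -esum_scale//.
  by apply: eq_esum => t _; rewrite /= normrM.
by rewrite lte_mul_pinfty// lee_fin.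
Qed.

Lemma nnsum_fin p : (forall t, 0 <= p t) -> abs_summable p ->
  (\esum_(t in [set: T]) (p t)%:E)%E \is a fin_num.
Proof.
move=> p0; rewrite /abs_summable summableE; congr (_ \is a fin_num).
by apply: eq_esum => t _; rewrite /= ger0_norm.
Qed.

Lemma nnsumD p q : (forall t, 0 <= p t) -> (forall t, 0 <= q t) ->
  abs_summable p -> abs_summable q ->
  nnsum (fun t => p t + q t) = nnsum p + nnsum q.
Proof.
move=> p0 q0 ps qs; rewrite /nnsum -fineD ?nnsum_fin//; congr fine.
by rewrite -esumD// => t _; rewrite lee_fin.
Qed.

Lemma nnsum_scale (c : R) p : 0 <= c -> (forall t, 0 <= p t) ->
  abs_summable p -> nnsum (fun t => c * p t) = c * nnsum p.
Proof.
move=> c0 p0 ps; rewrite /nnsum esum_scale//.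
by rewrite fineM ?nnsum_fin.
Qed.

Lemma nnsum_ge0 p : (forall t, 0 <= p t) -> 0 <= nnsum p.
Proof. by move=> p0; rewrite fine_ge0// esum_ge0// => t _; rewrite lee_fin. Qed.

Lemma rsumB_nnsum p q : (forall t, 0 <= p t) -> (forall t, 0 <= q t) ->
  abs_summable p -> abs_summable q ->
  rsum (fun t => p t - q t) = nnsum p - nnsum q.
Proof.
move=> p0 q0 ps qs.
rewrite /nnsum -fineB ?nnsum_fin// -esumB//.
- by move=> t _; rewrite lee_fin.
- by move=> t _; rewrite lee_fin.
Qed.

Lemma rsum_nnsum p : (forall t, 0 <= p t) -> abs_summable p ->
  rsum p = nnsum p.
Proof.
move=> p0 ps; have s0 : abs_summable (fun=> 0 : R).
  by apply: (@abs_summable_le _ p) => // t; rewrite normr0.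
transitivity (rsum (fun t => p t - 0)).
  by congr rsum; apply/funext => t; rewrite subr0.
rewrite rsumB_nnsum// [X in _ - X](_ : _ = 0) ?subr0//.
by rewrite /nnsum esum1.
Qed.

Let pos f t := Num.max (f t) 0.
Let neg f t := Num.max (- f t) 0.

Let posneg f : f = (fun t => pos f t - neg f t).
Proof.
apply/funext => t; rewrite /pos /neg.
by case: (leP (f t) 0) => f0; case: (leP (- f t) 0) => Nf0; lra.
Qed.

Let pos_ge0 f t : 0 <= pos f t. Proof. by rewrite le_max lexx orbT. Qed.
Let neg_ge0 f t : 0 <= neg f t. Proof. by rewrite le_max lexx orbT. Qed.

Let pos_sum f : abs_summable f -> abs_summable (pos f).
Proof.
move=> fs; apply: (@abs_summable_le _ (fun t => `|f t|)).
  by move=> t; rewrite ger0_norm ?pos_ge0// ge_max ler_norm normr_ge0.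
by apply: le_lt_trans fs; apply: le_esum => t _ /=; rewrite normr_id.
Qed.

Let neg_sum f : abs_summable f -> abs_summable (neg f).
Proof.
move=> fs; apply: (@abs_summable_le _ (fun t => `|f t|)).
  by move=> t; rewrite ger0_norm ?neg_ge0// ge_max -normrN ler_norm normr_ge0.
by apply: le_lt_trans fs; apply: le_esum => t _ /=; rewrite normr_id.
Qed.

(** Decomposing [f] and [g] into positive and negative parts gives a difference
    of nonnegative families for [f + g], not the canonical one, and
    [rsumB_nnsum] allows any such difference. *)
Lemma rsumD f g : abs_summable f -> abs_summable g ->
  rsum (fun t => f t + g t) = rsum f + rsum g.
Proof.
move=> fs gs; rewrite {2}(posneg f) {2}(posneg g).
rewrite !rsumB_nnsum//; try exact: pos_sum; try exact: neg_sum.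
transitivity (rsum (fun t => (pos f t + pos g t) - (neg f t + neg g t))).
  congr rsum; apply/funext => t; rewrite {1}(posneg f) {1}(posneg g).
  by rewrite opprD addrACA.
rewrite rsumB_nnsum.
- rewrite !nnsumD//; try exact: pos_sum; try exact: neg_sum.
  by rewrite opprD addrACA.
- by move=> t; rewrite addr_ge0 ?pos_ge0.
- by move=> t; rewrite addr_ge0 ?neg_ge0.
- by apply: abs_summableD; exact: pos_sum.
- by apply: abs_summableD; exact: neg_sum.
Qed.

Lemma rsumZ (c : R) f : abs_summable f -> rsum (fun t => c * f t) = c * rsum f.
Proof.
move=> fs; have nn (d : R) : 0 <= d -> rsum (fun t => d * f t) = d * rsum f.
  move=> d0; rewrite {2}(posneg f).
  rewrite !rsumB_nnsum//; try exact: pos_sum; try exact: neg_sum.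
  transitivity (rsum (fun t => d * pos f t - d * neg f t)).
    by congr rsum; apply/funext => t; rewrite {1}(posneg f) mulrBr.
  rewrite rsumB_nnsum.
  - rewrite !nnsum_scale//; try exact: pos_sum; try exact: neg_sum.
    by rewrite mulrBr.
  - by move=> t; rewrite mulr_ge0 ?pos_ge0.
  - by move=> t; rewrite mulr_ge0 ?neg_ge0.
  - by apply: abs_summable_scale; exact: pos_sum.
  - by apply: abs_summable_scale; exact: neg_sum.
have [c0|/ltW c0] := leP 0 c; first exact: nn.
apply/eqP; rewrite -subr_eq0 -mulNr -nn ?oppr_ge0// -rsumD.
- apply/eqP; rewrite (_ : (fun t => _) = (fun=> 0)).
    rewrite rsum_nnsum//; first by rewrite /nnsum esum1.
    by rewrite /abs_summable /summable esum1 ?ltry// => t _; rewrite /= normr0.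
  by apply/funext => t; rewrite mulNr subrr.
- exact: abs_summable_scale.
- exact: abs_summable_scale.
Qed.

Lemma eq_rsum f g : f =1 g -> rsum f = rsum g.
Proof. by move=> /funext ->. Qed.

Lemma csum_single (t : T) (f : T -> R[i]) : (forall s, s != t -> f s = 0) ->
  csum f = f t.
Proof.
move=> f0; rewrite /csum !(rsum_single (t := t)); first by case: (f t).
  by move=> s /f0 ->.
by move=> s /f0 ->.
Qed.

End UnorderedSums.

(** * The inner product of square-summable functions *)

Section InnerProduct.
Variables (R : realType) (T : choiceType).
Local Notation H := (ell2 R T).
Implicit Types (v w u : H) (a z : R[i]).
Local Notation Re := complex.Re.
Local Notation Im := complex.Im.

Lemma sqr_summable v : abs_summable (fun t => cabs (v t) ^+ 2).
Proof.
apply: le_lt_trans (ell2P v); apply: le_esum => t _ /=.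
by rewrite ger0_norm ?sqr_ge0.
Qed.

Lemma l2norm_nnsum v : l2norm v ^+ 2 = nnsum (fun t => cabs (v t) ^+ 2).
Proof. by rewrite /nnsum -[X in fine X]l2norm_sqr. Qed.

Lemma mulJ_summable v w : abs_summable (fun t => cabs (v t * (w t)^*%C)).
Proof.
apply: (@abs_summable_le _ _ _ (fun t => cabs (v t) ^+ 2 + cabs (w t) ^+ 2)).
  move=> t; rewrite ger0_norm ?cabs_ge0// cabsM cabsJ.
  by have := cabs_ge0 (v t); have := cabs_ge0 (w t); nra.
by apply: abs_summableD; exact: sqr_summable.
Qed.

Lemma ReJ_summable v w : abs_summable (fun t => Re (v t * (w t)^*%C)).
Proof. exact: abs_summable_le (fun t => Re_le_cabs _) (mulJ_summable v w). Qed.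

Lemma ImJ_summable v w : abs_summable (fun t => Im (v t * (w t)^*%C)).
Proof. exact: abs_summable_le (fun t => Im_le_cabs _) (mulJ_summable v w). Qed.

Lemma dot_linear a v w u : dot (a *: v + w) u = a * dot v u + dot w u.
Proof.
have Rv := ReJ_summable v u; have Iv := ImJ_summable v u.
have Rw := ReJ_summable w u; have Iw := ImJ_summable w u.
rewrite /dot /csum.
set zv := fun t => v t * (u t)^*%C; set zw := fun t => w t * (u t)^*%C.
have E t : (a *: v + w) t * (u t)^*%C = a * zv t + zw t.
  by rewrite -[(a *: v + w) t]/(a * v t + w t) mulrDl mulrA.
rewrite (@eq_rsum _ _ _ (fun t => (Re a * Re (zv t) + (- Im a) * Im (zv t)) +
    Re (zw t))); last by move=> t; rewrite E ReD ReM mulNr.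
rewrite (@eq_rsum _ _ (fun t => Im _)
    (fun t => (Re a * Im (zv t) + Im a * Re (zv t)) +
    Im (zw t))); last by move=> t; rewrite E ImD ImM.
have Z f (c : R) := @abs_summable_scale _ _ c f.
rewrite [in X in X +i* _]rsumD; [|by apply: abs_summableD; exact: Z|by []].
rewrite [in X in X +i* _]rsumD; [|exact: Z|exact: Z].
rewrite [in X in _ +i* X = _]rsumD; [|by apply: abs_summableD; exact: Z|by []].
rewrite [in X in _ +i* X = _]rsumD; [|exact: Z|exact: Z].
rewrite (rsumZ _ Rv) (rsumZ _ Iv) (rsumZ _ Rv) (rsumZ _ Iv).
by apply/eqP; rewrite eq_complex ReD ImD ReM ImM /= mulNr !eqxx.
Qed.

Lemma dotC v w : dot w v = (dot v w)^*%C.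
Proof.
rewrite /dot /csum /= ; apply/eqP; rewrite eq_complex /=; apply/andP; split.
  apply/eqP/eq_rsum => t; rewrite !ReM.
  by case: (v t) (w t) => [a b] [c d] /=; ring.
rewrite -mulN1r -rsumZ; last exact: ImJ_summable.
apply/eqP/eq_rsum => t; rewrite !ImM.
by case: (v t) (w t) => [a b] [c d] /=; ring.
Qed.

Lemma dotDl v w u : dot (v + w) u = dot v u + dot w u.
Proof. by rewrite -{1}[v]scale1r dot_linear mul1r. Qed.

Lemma dot0l u : dot 0 u = 0.
Proof. by apply: (addrI (dot 0 u)); rewrite -dotDl !addr0. Qed.

Lemma dotZl a v u : dot (a *: v) u = a * dot v u.
Proof. by rewrite -[a *: v]addr0 dot_linear dot0l addr0. Qed.

Lemma dotNl v u : dot (- v) u = - dot v u.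
Proof. by rewrite -scaleN1r dotZl mulN1r. Qed.

Lemma dotDr v w u : dot u (v + w) = dot u v + dot u w.
Proof. by rewrite dotC dotDl conjD -!dotC. Qed.

Lemma dotZr a v u : dot u (a *: v) = a^*%C * dot u v.
Proof. by rewrite dotC dotZl conjM -dotC. Qed.

Lemma dotvv v : dot v v = (l2norm v ^+ 2)%:C.
Proof.
rewrite l2norm_nnsum /dot /csum -rsum_nnsum; last 2 first.
- by move=> t; rewrite sqr_ge0.
- exact: sqr_summable.
apply/eqP; rewrite eq_complex /=; apply/andP; split; apply/eqP.
  by apply: eq_rsum => t; rewrite cabs_mulJ.
rewrite -(mul0r (rsum (fun t => Re (v t * (v t)^*%C)))) -rsumZ.
  by apply: eq_rsum => t; rewrite cabs_mulJ /= mul0r.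
exact: ReJ_summable.
Qed.

Lemma l2norm_subZ_sqr v w z : l2norm (v - z *: w) ^+ 2 =
  l2norm v ^+ 2 - 2 * Re (z^*%C * dot v w) + cabs z ^+ 2 * l2norm w ^+ 2.
Proof.
apply: complexI; rewrite -dotvv dotDl !dotDr -scaleNr !dotZl !dotZr !dotvv.
rewrite [dot w v]dotC conjN.
rewrite cabs_sqr; case: (dot v w) => c d; case: z => a b.
apply/eqP; rewrite eq_complex /=.
by apply/andP; split; apply/eqP; ring.
Qed.

Lemma l2norm_eq0 v : l2norm v = 0 -> v = 0.
Proof.
move=> v0; apply: ell2_eqP => t; apply: cabs_eq0; apply/eqP.
by rewrite eq_le cabs_ge0 andbT -v0 cabs_le_l2norm.
Qed.

Lemma l2norm0 : l2norm (0 : H) = 0.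
Proof.
by apply/eqP; rewrite -sqrf_eq0 -(inj_eq (@complexI _)) -dotvv dot0l.
Qed.

Lemma l2normZ z v : l2norm (z *: v) = cabs z * l2norm v.
Proof.
apply/eqP; rewrite -(@eqrXn2 _ 2)// ?mulr_ge0 ?cabs_ge0 ?l2norm_ge0//.
rewrite exprMn -(inj_eq (@complexI _)) -dotvv dotZl dotZr mulrA cabs_mulJ dotvv.
by rewrite -rmorphM.
Qed.

Lemma l2normN v : l2norm (- v) = l2norm v.
Proof. by rewrite -scaleN1r l2normZ cabsN cabs1 mul1r. Qed.

Lemma l2norm_subC v w : l2norm (v - w) = l2norm (w - v).
Proof. by rewrite -l2normN opprB. Qed.

(** [z *: w] is the orthogonal projection of [v] on the line of [w]; the factor
    [l2norm w ^+ 2] avoids a division and covers [w = 0]. This identity gives the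
    Cauchy-Schwarz inequality as well as the near-orthogonality of minimising
    sequences. *)
Lemma line_projection v w : exists z,
  l2norm (v - z *: w) ^+ 2 * l2norm w ^+ 2 =
  l2norm v ^+ 2 * l2norm w ^+ 2 - cabs (dot v w) ^+ 2.
Proof.
have [w0|wn0] := eqVneq (l2norm w) 0.
  exists 0; rewrite (l2norm_eq0 w0) scaler0 subr0 dotC dot0l conjc0 cabs0.
  by rewrite expr0n subr0.
set d := dot v w; set b := l2norm w in wn0 *.
exists ((b ^- 2)%:C * d).
rewrite l2norm_subZ_sqr -/d -/b.
have -> : (((b ^- 2)%:C * d)^*)%C * d = (b ^- 2 * cabs d ^+ 2)%:C.
  by rewrite conjM conjR -mulrA [_^*%C * d]mulrC cabs_mulJ -rmorphM.
rewrite cabsM cabsR ger0_norm ?invr_ge0 ?sqr_ge0//.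
have -> (x : R) : Re x%:C = x by [].
by field.
Qed.

Lemma cauchy_schwarz v w : cabs (dot v w) <= l2norm v * l2norm w.
Proof.
rewrite -ler_sqr ?nnegrE ?mulr_ge0 ?cabs_ge0 ?l2norm_ge0// exprMn -subr_ge0.
by have [z <-] := line_projection v w; rewrite mulr_ge0 ?sqr_ge0.
Qed.

Lemma ler_l2normD v w : l2norm (v + w) <= l2norm v + l2norm w.
Proof.
rewrite -ler_sqr ?nnegrE ?addr_ge0 ?l2norm_ge0//.
have := l2norm_subZ_sqr v w (-1); rewrite scaleN1r opprK => ->.
have -> : ((-1)^*)%C = -1 :> R[i] by rewrite conjN [X in - X](conjR 1).
rewrite cabsN cabs1 mulN1r expr1n mul1r.
have -> : Re (- dot v w) = - Re (dot v w) by case: (dot v w).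
have := le_trans (le_trans (ler_norm _) (Re_le_cabs _)) (cauchy_schwarz v w).
lra.
Qed.

Lemma l2norm_sum (J : Type) (r : seq J) (F : J -> H) :
  l2norm (\sum_(j <- r) F j) <= \sum_(j <- r) l2norm (F j).
Proof.
elim: r => [|j r IH]; first by rewrite !big_nil l2norm0.
by rewrite !big_cons (le_trans (ler_l2normD _ _))// lerD2l.
Qed.

End InnerProduct.

(** * Completeness and distance to a subspace *)

Section Completeness.
Variables (R : realType) (T : choiceType).
Local Notation H := (ell2 R T).
Implicit Types (v w u : H).

Lemma ell2_sumE (J : Type) (r : seq J) (F : J -> H) t :
  (\sum_(j <- r) F j) t = \sum_(j <- r) F j t.
Proof.
elim: r => [|j r IH]; first by rewrite !big_nil.
by rewrite !big_cons -IH.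
Qed.

Definition trunc (r : seq T) v : H := \sum_(t <- r) v t *: delta R t.

Lemma truncE r v s : uniq r -> trunc r v s = if s \in r then v s else 0.
Proof.
move=> ur; rewrite ell2_sumE.
rewrite (eq_bigr (fun t => v t * (s == t)%:R)) => [|t _]; last by [].
case: ifPn => [sr|sr].
  rewrite (bigD1_seq s)//= eqxx mulr1 big1 ?addr0// => t ts.
  by rewrite eq_sym (negbTE ts) mulr0.
rewrite big_seq big1// => t tr; rewrite (_ : (s == t) = false) ?mulr0//.
by apply/negbTE; apply: contraNneq sr => ->.
Qed.

Lemma sqsum_cond v (A : set T) : sqsum (fun t => if t \in A then v t else 0) =
  (\esum_(t in A) (cabs (v t) ^+ 2)%:E)%E.
Proof.
rewrite [RHS]esum_mkcond; apply: eq_esum => t _.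
by case: ifP => // _; rewrite cabs0 expr0n.
Qed.

Lemma trunc_approx v (e : R) : 0 < e -> exists r, l2norm (v - trunc r v) < e.
Proof.
move=> e0; have e20 : 0 < e ^+ 2 by rewrite exprn_gt0.
have [_ [F [finF _] <-] hF] := ub_ereal_sup_adherent e20 (sqsum_fin v).
pose r : seq T := finmap.enum_fset (fset_set F); exists r.
have rF t : (t \in r) = (t \in F) by rewrite -in_fset_set.
rewrite -ltr_sqr ?nnegrE ?l2norm_ge0 ?ltW// -lte_fin l2norm_sqr.
have -> : sqsum (v - trunc r v : H) =
    (\esum_(t in ~` F) (cabs (v t) ^+ 2)%:E)%E.
  rewrite -sqsum_cond; congr sqsum; apply/funext => t.
  rewrite -[LHS]/(v t - trunc r v t) truncE ?finmap.fset_uniq// rF in_setC.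
  case: (t \in F) => /=; first by rewrite subrr.
  by rewrite subr0.
have E : (sqsum v = \sum_(t \in F) (cabs (v t) ^+ 2)%:E +
    \esum_(t in ~` F) (cabs (v t) ^+ 2)%:E)%E.
  rewrite /sqsum (esumID F); last by move=> t _; rewrite lee_fin sqr_ge0.
  by rewrite !setTI esum_fset// => t _; rewrite lee_fin sqr_ge0.
move: hF; rewrite -[ereal_sup _]/(sqsum v) {1}E.
have := sqsum_fin v; rewrite E.
set x := (\sum_(_ \in _) _)%E; set y := (\esum_(_ in _) _)%E.
have y0 : (0 <= y)%E by apply: esum_ge0 => t _; rewrite lee_fin sqr_ge0.
have : x \is a fin_num.
  by rewrite /x fsbig_finite//= sumEFin.
case: x y y0 {E} => [x||] [y||]//= _ _ _; rewrite !lte_fin; lra.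
Qed.

Lemma real_cauchy (x : nat -> R) :
  (forall e : R, 0 < e -> exists N, forall n m, (N <= n)%N -> (N <= m)%N ->
    `|x n - x m| <= e) -> exists l : R, x @ \oo --> l.
Proof.
move=> xc; suff: cvg (x @ \oo) by move=> cx; exists (lim (x @ \oo)).
apply/cauchy_cvgP/cauchy_exP => e e0.
have [N xN] := xc (e / 2) (divr_gt0 e0 (ltr0Sn _ 1)).
exists (x N); exists N => // n /= Nn.
rewrite -ball_normE /=; apply: le_lt_trans (xN _ _ _ _) _ => //.
by rewrite ltr_pdivrMr// ltr_pMr// ltrDl.
Qed.

Lemma l2norm_le_finite (x : T -> R[i]) (c : R) : 0 <= c ->
  (forall r : seq T, uniq r -> \sum_(t <- r) cabs (x t) ^+ 2 <= c ^+ 2) ->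
  exists2 v : H, v =1 x & l2norm v <= c.
Proof.
move=> c0 xc; have sx : (sqsum x <= (c ^+ 2)%:E)%E.
  apply: ge_ereal_sup => _ [F [finF _] <-].
  by rewrite fsbig_finite//= sumEFin lee_fin xc// finmap.fset_uniq.
have sx' : sqsummable x by apply: le_lt_trans sx _; rewrite ltry.
exists (Ell2 sx') => //.
by rewrite -ler_sqr ?nnegrE ?l2norm_ge0// -lee_fin l2norm_sqr.
Qed.

Lemma finite_le_l2norm v (r : seq T) : uniq r ->
  \sum_(t <- r) cabs (v t) ^+ 2 <= l2norm v ^+ 2.
Proof.
move=> ur; rewrite -lee_fin l2norm_sqr -sumEFin.
apply: ereal_sup_ubound; exists [set` r]; first by split => //; exact: finite_seq.
by rewrite -fsbig_seq.
Qed.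

(** Coordinatewise limits exist since the reals are complete; the bound on the
    differences passes to the limit on finite sets of coordinates. *)
Lemma ell2_complete (x : nat -> H) :
  (forall e : R, 0 < e -> exists N, forall n m, (N <= n)%N -> (N <= m)%N ->
    l2norm (x n - x m) <= e) ->
  exists y : H, forall e : R, 0 < e -> exists N, forall n, (N <= n)%N ->
    l2norm (x n - y) <= e.
Proof.
move=> xc.
have coord (p : R[i] -> R) t : (forall z, `|p z| <= cabs z) ->
    (forall a b : R[i], p (a - b) = p a - p b) ->
    exists l : R, (fun n => p (x n t)) @ \oo --> l.
  move=> p1 pB; apply: (@real_cauchy (fun n => p (x n t))) => e /xc[N xN].
  exists N => n m Nn Nm.
  rewrite -pB (le_trans (p1 _))//.
  exact: le_trans (cabs_le_l2norm (x n - x m) t) (xN _ _ Nn Nm).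
have ReB (z w : R[i]) : complex.Re (z - w) = complex.Re z - complex.Re w.
  by case: z w => [a b] [c d].
have ImB (z w : R[i]) : complex.Im (z - w) = complex.Im z - complex.Im w.
  by case: z w => [a b] [c d].
have /choice[a xa] := fun t => coord _ t (@Re_le_cabs R) ReB.
have /choice[b xb] := fun t => coord _ t (@Im_le_cabs R) ImB.
have tail e N : 0 < e -> (forall n m, (N <= n)%N -> (N <= m)%N ->
    l2norm (x n - x m) <= e) -> forall n, (N <= n)%N ->
    exists2 v : H, (forall t, v t = x n t - (a t +i* b t)) & l2norm v <= e.
  move=> e0 xN n Nn; apply: l2norm_le_finite; first exact: ltW.
  move=> r ur.
  have cv : (fun m => \sum_(t <- r) cabs (x n t - x m t) ^+ 2) @ \oo -->
      \sum_(t <- r) cabs (x n t - (a t +i* b t)) ^+ 2.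
    clear ur; elim: r => [|t r IH].
      by rewrite big_nil; under eq_fun do rewrite big_nil; exact: cvg_cst.
    rewrite big_cons; under eq_fun do rewrite big_cons.
    apply: cvgD => //.
    under eq_fun do rewrite cabs_sqr ReB ImB.
    rewrite cabs_sqr ReB ImB /=.
    apply: cvgD; rewrite expr2; under eq_fun do rewrite expr2;
      by apply: cvgM; apply: cvgB; (exact: cvg_cst || exact: xa || exact: xb).
  rewrite -(cvg_lim _ cv)//; apply: limr_le; first by apply/cvg_ex; eexists; exact: cv.
  exists N => // m /= Nm; apply: le_trans (finite_le_l2norm (x n - x m) ur) _.
  by rewrite ler_sqr ?nnegrE ?l2norm_ge0 ?xN// ltW.
have [N xN] := xc _ ltr01.
have [v vE _] := tail _ _ ltr01 xN N (leqnn N).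
(* the square-summable limit is reached from the term [x N], from which it
   differs by a square-summable function *)
exists (x N - v) => e e0; have [N' xN'] := xc _ e0.
exists N' => n Nn; have [w wE we] := tail _ _ e0 xN' n Nn.
rewrite (_ : x n - (x N - v) = w)//; apply: ell2_eqP => t.
rewrite -[LHS]/(x n t - (x N t - v t)) wE vE; congr (_ - _).
by rewrite opprB addrC subrK.
Qed.

(** The distance from [xi] to the subspace [V] is attained in the limit by a
    minimising sequence, whose residues converge to a vector orthogonal to [V];
    that vector is then orthogonal to [xi] and hence to itself. *)
Lemma subspace_approx (V : set H) (xi : H) :
  V 0 -> (forall a v w, V v -> V w -> V (a *: v + w)) ->
  (forall w, (forall v, V v -> dot v w = 0) -> dot xi w = 0) ->
  forall e : R, 0 < e -> exists2 v, V v & l2norm (xi - v) < e.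
Proof.
move=> V0 Vlin Vort e e0.
pose S := [set l2norm (xi - v) ^+ 2 | v in V]; pose d := inf S.
have infS : has_inf S.
  split; first by exists (l2norm (xi - 0) ^+ 2), 0.
  by exists 0 => _ [v _ <-]; rewrite sqr_ge0.
have dle v : V v -> d <= l2norm (xi - v) ^+ 2.
  by move=> Vv; apply: ge_inf; [exact: infS.2|exists v].
have step n : exists v, V v /\ l2norm (xi - v) ^+ 2 < d + n.+1%:R^-1.
  have n0 : 0 < n.+1%:R^-1 :> R by rewrite invr_gt0.
  by have [_ [v Vv <-] vd] := inf_adherent n0 infS; exists v.
have /choice[v /all_and2[Vv vd]] := step; pose w n := xi - v n.
have VZ a u : V u -> V (a *: u) by move=> Vu; rewrite -[_ *: _]addr0; apply: Vlin.
have small (c : R) : 0 < c -> exists N, forall n, (N <= n)%N -> n.+1%:R^-1 <= c.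
  move=> c0; exists (Num.truncn c^-1) => n Nn.
  rewrite invf_ple ?posrE ?invr_gt0 ?ltr0n//.
  apply: ltW; apply: lt_le_trans (truncnS_gt _) _.
  by rewrite ler_nat ltnS.
(* the projection of [w n] on the line of [u] cannot bring it closer than [d] *)
have ortho n u : V u ->
    cabs (dot (w n) u) ^+ 2 <= l2norm u ^+ 2 * n.+1%:R^-1.
  move=> Vu; have [z zE] := line_projection (w n) u.
  have dz : d <= l2norm (w n - z *: u) ^+ 2.
    have -> : w n - z *: u = xi - (z *: u + v n) by rewrite opprD addrA addrAC.
    by apply: dle; apply: Vlin.
  have wn : l2norm (w n) ^+ 2 - l2norm (w n - z *: u) ^+ 2 <= n.+1%:R^-1.
    by rewrite lerBlDr (le_trans (ltW (vd n)))// addrC lerD2l.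
  have -> : cabs (dot (w n) u) ^+ 2 =
      l2norm u ^+ 2 * (l2norm (w n) ^+ 2 - l2norm (w n - z *: u) ^+ 2).
    by rewrite mulrC mulrBl zE opprB addrC subrK.
  by rewrite ler_wpM2l ?sqr_ge0.
(* parallelogram identity: the midpoint of [v n] and [v m] is in [V], hence not
   closer to [xi] than [d] *)
have cau : forall c : R, 0 < c -> exists N, forall n m, (N <= n)%N -> (N <= m)%N ->
    l2norm (w n - w m) <= c.
  move=> c c0; have [N hN] := small (c ^+ 2 / 4) (divr_gt0 (exprn_gt0 2 c0) (ltr0Sn _ _)).
  exists N => n m Nn Nm; rewrite -ler_sqr ?nnegrE ?l2norm_ge0 ?ltW//.
  pose u := 2^-1 *: v n + 2^-1 *: v m.
  have du : d <= l2norm (xi - u) ^+ 2 by apply: dle; apply: Vlin => //; exact: VZ.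
  have E1 := l2norm_subZ_sqr (w n) (w m) 1.
  have E2 := l2norm_subZ_sqr (w n) (w m) (-1).
  have E3 : l2norm (w n - (-1) *: w m) ^+ 2 = 4 * l2norm (xi - u) ^+ 2.
    have -> : w n - (-1) *: w m = 2 *: (xi - u).
      rewrite scaleN1r opprK /u scalerBr scalerDr !scalerA divff ?pnatr_eq0//.
      by rewrite !scale1r scaler_nat mulr2n /w opprD addrACA.
    by rewrite l2normZ exprMn -[2 : R[i]](rmorph_nat (real_complex R)) cabsR normr_nat -natrX.
  have ReN (z : R[i]) : complex.Re (((-1)^*)%C * z) = - complex.Re ((1^*)%C * z).
    by rewrite conjN conjc1 mulN1r mul1r; case: z.
  move: E1 E2; rewrite ReN cabsN cabs1 expr1n !mul1r scale1r E3.
  have := vd n; have := vd m; have := hN _ Nn; have := hN _ Nm.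
  rewrite -/(w n) -/(w m).
  set kn := n.+1%:R^-1; set km := m.+1%:R^-1; lra.
have [y hy] := ell2_complete cau.
have yort u : V u -> dot u y = 0.
  move=> Vu; suff: cabs (dot y u) = 0
    by move=> /cabs_eq0 yu; rewrite dotC yu; exact: conjc0.
  apply/eqP; rewrite eq_le cabs_ge0 andbT; apply/ler_addgt0Pr => c c0.
  have u1 : 0 < l2norm u + 1 by rewrite ltr_wpDl ?l2norm_ge0.
  have [c' c'0 cE] : exists2 c', 0 < c' & c = 2 * (c' * (l2norm u + 1)).
    exists (c / 2 / (l2norm u + 1)); first by rewrite !divr_gt0.
    by field; rewrite gt_eqF.
  have [N hN] := hy _ c'0; have [N' hN'] := small (c' ^+ 2) (exprn_gt0 2 c'0).
  pose n := maxn N N'.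
  have b1 : cabs (dot (w n) u) <= l2norm u * c'.
    rewrite -ler_sqr ?nnegrE ?mulr_ge0 ?cabs_ge0 ?l2norm_ge0 ?(ltW c'0)//.
    rewrite exprMn (le_trans (ortho _ _ Vu))// ler_wpM2l ?sqr_ge0//.
    by rewrite hN'// leq_maxr.
  have b2 : cabs (dot (y - w n) u) <= c' * l2norm u.
    apply: (le_trans (cauchy_schwarz _ _)); rewrite ler_wpM2r ?l2norm_ge0//.
    by rewrite l2norm_subC hN// leq_maxl.
  have -> : dot y u = dot (y - w n) u + dot (w n) u by rewrite -dotDl subrK.
  rewrite add0r; apply: (le_trans (ler_cabsD _ _)).
  have := l2norm_ge0 u; rewrite cE; nra.
have xiy := Vort _ yort.
have wy n : dot (w n) y = 0 by rewrite dotDl dotNl xiy yort// subr0.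
have y0 : y = 0.
  apply: l2norm_eq0; apply/eqP; rewrite eq_le l2norm_ge0 andbT.
  apply/ler_addgt0Pr => c c0; have [N hN] := hy _ c0; rewrite add0r.
  have := cauchy_schwarz (y - w N) y.
  rewrite dotDl dotNl wy subr0 dotvv cabsR ger0_norm ?sqr_ge0// expr2.
  rewrite (l2norm_subC y); have := hN N (leqnn N); have := l2norm_ge0 y; nra.
have [N hN] := hy _ (divr_gt0 e0 (ltr0Sn _ 1)).
exists (v N) => //; have := hN N (leqnn N); rewrite y0 subr0 -/(w N).
by move=> /le_lt_trans; apply; rewrite ltr_pdivrMr// ltr_pMr// ltrDl.
Qed.

End Completeness.

(** * Ultraweak closures of operator subspaces *)

Section UltraweakClosure.
Variables (R : realType) (T : choiceType).
Local Notation H := (ell2 R T).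
Local Notation B := (bop R T).

(** A single pair of vectors is padded with zeros to a pair of square-summable
    sequences, as the topology is given by such sequences. *)
Lemma vector_functional_continuous (v w : H) :
  continuous ((fun A : B => dot (A v) w) : ultraweak R T -> R[i]^o).
Proof.
pose single (u : H) (n : nat) := if n == 0%N then u else 0.
have single_sum u : sqsummable_seq (single u).
  rewrite /sqsummable_seq (esumID [set 0%N])/=; last first.
    by move=> n _; rewrite lee_fin sqr_ge0.
  rewrite setTI esum_set1 ?lee_fin ?sqr_ge0// esum1 ?adde0 ?ltry//.
  by move=> n [_ /= /eqP/negPf n0]; rewrite /single n0 l2norm0 expr0n.
pose p : uw_index R T := exist _ (single v, single w) (conj (single_sum v) (single_sum w)).
have E : (fun A : B => dot (A v) w) = (fun A : B => uw_eval A p).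
  apply/funext => A; rewrite /uw_eval (csum_single (t := 0%N))//= => n /negPf n0.
  by rewrite /single n0 dotC dot0l conjc0.
rewrite E => A; apply: (@continuous_comp (ultraweak R T) _ _ (@uw_eval R T) (fun f => f p)).
  exact: initial_continuous.

exact: (@proj_continuous {classic (uw_index R T)} (fun=> R[i]^o) p).
Qed.

(** A vector orthogonal to all [A xi] is orthogonal to [C xi], because the
    corresponding functional is ultraweakly continuous; so the distance from
    [C xi] to the subspace of the vectors [A xi] is zero. *)
Lemma ultraweak_closure_approx (S : set B) (C : B) (xi : H) (e : R) :
  S 0 -> (forall a A A', S A -> S A' -> S (a *: A + A')) ->
  closure (S : set (ultraweak R T)) C -> 0 < e ->
  exists2 A, S A & l2norm (C xi - A xi) < e.
Proof.
move=> S0 Slin clC e0.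
have [||w wort|_ [A SA <-]] := @subspace_approx R T [set A xi | A in S] (C xi) _ _ _ e e0.
- by exists 0.
- by move=> a _ _ [A SA <-] [A' SA' <-]; exists (a *: A + A') => //; exact: Slin.
- apply/eqP/negPn/negP => Cw.
  have := @vector_functional_continuous xi w C.
  move=> /(@cvgr_neq0 _ _ _ _ _ _) /(_ Cw) /clC[A [SA /eqP]].
  by apply; apply: wort; exists A.
- by exists A.
Qed.

End UltraweakClosure.

(** * Bounded operators *)

Section Operators.
Variables (R : realType) (T : choiceType).
Local Notation H := (ell2 R T).
Local Notation B := (bop R T).
Implicit Types (A C : B) (v w : H).

Lemma bopDE A C v : (A + C) v = A v + C v. Proof. by []. Qed.
Lemma bopBE A C v : (A - C) v = A v - C v. Proof. by []. Qed.
Lemma bopZE (a : R[i]) A v : (a *: A) v = a *: A v. Proof. by []. Qed.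
Lemma bopME A C v : (A * C) v = A (C v). Proof. by []. Qed.

Lemma bop_sumE (J : Type) (r : seq J) (F : J -> B) v :
  (\sum_(j <- r) F j) v = \sum_(j <- r) F j v.
Proof.
elim: r => [|j r IH]; first by rewrite !big_nil.
by rewrite !big_cons -IH.
Qed.

Lemma bop0 A : A 0 = 0.
Proof. by apply: (addrI (A 0)); rewrite -bopD !addr0. Qed.

Lemma bopZ A (a : R[i]) v : A (a *: v) = a *: A v.
Proof. by rewrite -[a *: v]addr0 bop_linear bop0 addr0. Qed.

Lemma bopN A v : A (- v) = - A v.
Proof. by rewrite -(scaleN1r v) bopZ scaleN1r. Qed.

Lemma bopB A v w : A (v - w) = A v - A w.
Proof. by rewrite bopD bopN. Qed.

Lemma bop_sum A (J : Type) (r : seq J) (F : J -> H) :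
  A (\sum_(j <- r) F j) = \sum_(j <- r) A (F j).
Proof.
elim: r => [|j r IH]; first by rewrite !big_nil bop0.
by rewrite !big_cons -IH bopD.
Qed.

Lemma mulbZl (a : R[i]) A C : (a *: A) * C = a *: (A * C).
Proof. exact: bop_eqP. Qed.

Lemma mulbZr (a : R[i]) A C : A * (a *: C) = a *: (A * C).
Proof. by apply: bop_eqP => v; rewrite !(bopME, bopZE) bopZ. Qed.

Lemma opnorm_le A (c : R) : (forall v, l2norm v <= 1 -> l2norm (A v) <= c) ->
  opnorm A <= c.
Proof.
move=> Ac; apply: ge_sup; last by move=> _ [v v1 <-]; exact: Ac.
by exists (l2norm (A 0)), 0 => //=; rewrite l2norm0.
Qed.

Lemma opnorm_ball A v : l2norm v <= 1 -> l2norm (A v) <= opnorm A.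
Proof.
move=> v1; apply: ub_le_sup; last by exists v.
have [c c0 Ac] := bop_bounded A; exists c => _ [w /= w1 <-].
by rewrite (le_trans (Ac w))// ler_piMr.
Qed.

Lemma opnorm_ge0 A : 0 <= opnorm A.
Proof. by apply: le_trans (@opnorm_ball A 0 _); rewrite ?l2norm0 ?l2norm_ge0. Qed.

Lemma opnormP A v : l2norm (A v) <= opnorm A * l2norm v.
Proof.
have [v0|vn0] := eqVneq (l2norm v) 0.
  by rewrite (l2norm_eq0 v0) bop0 l2norm0 mulr0.
have v0 : 0 < l2norm v by rewrite lt0r vn0 l2norm_ge0.
have := @opnorm_ball A ((l2norm v)^-1%:C *: v).
rewrite bopZ !l2normZ cabsR ger0_norm ?invr_ge0 ?(ltW v0)// mulVf//.
by move=> /(_ (lexx _)); rewrite ler_pdivrMl// mulrC.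
Qed.

Lemma opnorm_contraction A v : opnorm A <= 1 -> l2norm (A v) <= l2norm v.
Proof.
move=> A1; apply: le_trans (opnormP A v) _.
by rewrite ler_piMl// l2norm_ge0.
Qed.

Lemma commutant_linear (S : set B) (z : R[i]) A C :
  commutant S A -> commutant S C -> commutant S (z *: A + C).
Proof.
move=> SA SC D SD; rewrite mulrDl mulrDr mulbZl mulbZr.
by rewrite (SA D SD) (SC D SD).
Qed.

Lemma commutant0 (S : set B) : commutant S 0.
Proof. by move=> A _; rewrite mul0r mulr0. Qed.

Lemma commutantZ (S : set B) (z : R[i]) A : commutant S A -> commutant S (z *: A).
Proof.
by move=> SA; rewrite -[_ *: _]addr0; apply: commutant_linear => //; exact: commutant0.
Qed.

Lemma commutantB (S : set B) A C : commutant S A -> commutant S C ->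
  commutant S (A - C).
Proof. by move=> SA SC; rewrite addrC -scaleN1r; exact: commutant_linear. Qed.

Lemma commutant_sum (S : set B) (J : Type) (l : seq J) (F : J -> B) :
  (forall j, commutant S (F j)) -> commutant S (\sum_(j <- l) F j).
Proof.
move=> SF; elim: l => [|j l IH]; first by rewrite big_nil; exact: commutant0.
by rewrite big_cons -[F j]scale1r; exact: commutant_linear.
Qed.

Lemma commutator_sumr A (J : Type) (l : seq J) (z : J -> R[i]) (F : J -> B) :
  commutator A (\sum_(j <- l) z j *: F j) = \sum_(j <- l) z j *: commutator A (F j).
Proof.
rewrite /commutator mulr_sumr mulr_suml -sumrB; apply: eq_bigr => j _.
by rewrite mulbZl mulbZr scalerBr.
Qed.

Lemma opnorm0 : opnorm (0 : B) <= 0.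
Proof. by apply: opnorm_le => v _; rewrite -[(0 : B) v]/(0 : H) l2norm0. Qed.

(** Both sides are linear and continuous in [w], and finitely supported vectors
    are dense. This expresses rows of [A] as vectors. *)
Lemma coordinate_dot A s (b : H) : (forall t, A (delta R t) s = (b t)^*%C) ->
  forall w, A w s = dot w b.
Proof.
move=> Ab w; apply/eqP; rewrite -subr_eq0; apply/eqP/cabs_eq0/eqP.
rewrite eq_le cabs_ge0 andbT; apply/ler_addgt0Pr => e e0; rewrite add0r.
set k := opnorm A + l2norm b + 1.
have k0 : 0 < k by rewrite ltr_wpDl ?addr_ge0 ?opnorm_ge0 ?l2norm_ge0.
have [r hr] := trunc_approx w (divr_gt0 e0 k0).
have tE : A (trunc r w) s = dot (trunc r w) b.
  rewrite /trunc bop_sum ell2_sumE.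
  have -> : dot (\sum_(t <- r) w t *: delta R t) b = \sum_(t <- r) w t * (b t)^*%C.
    elim: r {hr} => [|t r IH]; first by rewrite !big_nil dot0l.
    by rewrite !big_cons dotDl IH dotZl delta_dot.
  by apply: eq_bigr => t _; rewrite bopZ -Ab.
have -> : A w s - dot w b = A (w - trunc r w) s - dot (w - trunc r w) b.
  by rewrite bopB dotDl dotNl -tE opprB addrA; congr (_ - _); rewrite [RHS]subrK.
apply: (le_trans (ler_cabsD _ _)); rewrite cabsN.
have h1 := le_trans (cabs_le_l2norm (A (w - trunc r w)) s) (opnormP A _).
have h2 := cauchy_schwarz (w - trunc r w) b.
apply: (le_trans (lerD h1 h2)); rewrite mulrC -mulrDr.
move: hr; rewrite ltr_pdivlMr// => /ltW; apply: le_trans.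
by rewrite ler_wpM2l ?l2norm_ge0// lerDl.
Qed.

End Operators.

(** * Multiplication operators and diagonals *)

Section DiagonalOperators.
Variables (R : realType) (T : choiceType).
Local Notation H := (ell2 R T).
Local Notation B := (bop R T).
Local Notation Linfty := (linf R T).
Implicit Types (f g : Linfty) (A C : B) (t s : T).

Lemma linf_eqP f g : (forall t, f t = g t) -> f = g.
Proof. by move=> fg; apply/val_inj/funext. Qed.

Lemma linfDE f g t : (f + g) t = f t + g t. Proof. by []. Qed.

Lemma linfNE f t : (- f) t = - f t. Proof. by []. Qed.

Lemma linfZE (a : R[i]) f t : (a *: f) t = a * f t. Proof. by []. Qed.

Lemma linfME f g t : (f * g) t = f t * g t. Proof. by []. Qed.

Lemma bounded_linf (u : T -> R[i]) (c : R) : (forall t, cabs (u t) <= c) ->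
  exists f : Linfty, forall t, f t = u t.
Proof. by move=> uc; exists (Linf (introT (asboolP _) (ex_intro _ c uc))). Qed.

Lemma diagE A t : diag A t = A (delta R t) t. Proof. by []. Qed.

Lemma diag_linear (z : R[i]) A C : diag (z *: A + C) = z *: diag A + diag C.
Proof. exact: linf_eqP. Qed.

Lemma diag0 : diag (0 : B) = 0.
Proof. exact: linf_eqP. Qed.

Lemma diag_sum (J : Type) (l : seq J) (F : J -> B) :
  diag (\sum_(j <- l) F j) = \sum_(j <- l) diag (F j).
Proof.
elim: l => [|j l IH]; first by rewrite !big_nil diag0.
by rewrite !big_cons -IH; exact: linf_eqP.
Qed.

Lemma mulopE f (v : H) t : mulop f v t = f t * v t. Proof. by []. Qed.

Lemma mulop_linear (z : R[i]) f g : mulop (z *: f + g) = z *: mulop f + mulop g.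
Proof.
apply: bop_eqP => v; apply: ell2_eqP => t.
rewrite -[RHS]/(z * (f t * v t) + g t * v t) mulopE linfDE linfZE mulrDl.
by rewrite mulrA.
Qed.

Lemma mulopZ (z : R[i]) f : mulop (z *: f) = z *: mulop f.
Proof.
apply: bop_eqP => v; apply: ell2_eqP => t.
by rewrite mulopE linfZE -mulrA.
Qed.

Lemma mulop_positive f : (forall t, 0 <= f t) -> positive_bop (mulop f).
Proof.
move=> f0 v; rewrite /dot /csum.
have E t : mulop f v t * (v t)^*%C = (cabs (f t) * cabs (v t) ^+ 2)%:C.
  by rewrite mulopE -mulrA cabs_mulJ {1}(ge0_cabsE (f0 t)) -rmorphM.
rewrite lecE /=; apply/andP; split.
  rewrite (@eq_rsum _ _ _ (fun=> 0)) => [|t]; last by rewrite E.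
  by rewrite rsum_nnsum// ?/nnsum ?esum1// /abs_summable /summable esum1 ?ltry// => t _;
    rewrite /= normr0.
rewrite rsum_nnsum.
- by apply: nnsum_ge0 => t; rewrite E /= mulr_ge0 ?sqr_ge0 ?cabs_ge0.
- by move=> t; rewrite E /= mulr_ge0 ?sqr_ge0 ?cabs_ge0.
- exact: (ReJ_summable (mulop f v) v).
Qed.

Lemma pointwise_l2norm_le (v w : H) (e : R) : 0 <= e ->
  (forall t, cabs (v t) <= e * cabs (w t)) -> l2norm v <= e * l2norm w.
Proof. by move=> e0 vw; apply: l2norm_le => //; exact: le_sqsum. Qed.

End DiagonalOperators.

(** * Translations and the group von Neumann algebra *)

Section GroupOperators.
Variables (R : realType) (G : groupType).
Local Notation H := (ell2 R G).
Local Notation B := (bop R G).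
Local Notation delta1 := (delta R (1%g : G)).
Implicit Types (A C K x y a c : B) (v w : H) (s t u r : G).

Lemma lambdaE t v s : lambda R t v s = v (t^-1 * s)%g. Proof. by []. Qed.
Lemma rhoE t v s : rho R t v s = v (s * t)%g. Proof. by []. Qed.

Lemma lambda_delta t s : lambda R t (delta R s) = delta R (t * s)%g.
Proof.
apply: ell2_eqP => u /=; rewrite /delta_fun.
by rewrite -{1}(mulKg t s) (can_eq (mulKg t^-1)%g).
Qed.

Lemma rho_delta t s : rho R t (delta R s) = delta R (s * t^-1)%g.
Proof.
apply: ell2_eqP => u /=; rewrite /delta_fun.
by rewrite -{2}(mulgK t u) (can_eq (mulgVK t)).
Qed.

Lemma lambdaM s t : lambda R s * lambda R t = lambda R (s * t)%g.
Proof.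
apply: bop_eqP => v; apply: ell2_eqP => u.
by rewrite bopME !lambdaE invgM mulgA.
Qed.

Lemma lambda1 : lambda R (1%g : G) = 1.
Proof. by apply: bop_eqP => v; apply: ell2_eqP => u; rewrite lambdaE invg1 mul1g. Qed.

Lemma rho1 : rho R (1%g : G) = 1.
Proof. by apply: bop_eqP => v; apply: ell2_eqP => u; rewrite rhoE mulg1. Qed.

Lemma rhoM s t : rho R s * rho R t = rho R (s * t)%g.
Proof.
by apply: bop_eqP => v; apply: ell2_eqP => u; rewrite bopME !rhoE mulgA.
Qed.

Lemma lambda_rho s t : lambda R s * rho R t = rho R t * lambda R s.
Proof.
by apply: bop_eqP => v; apply: ell2_eqP => u; rewrite !bopME !(lambdaE, rhoE) mulgA.
Qed.

Lemma l2norm_lambda t v : l2norm (lambda R t v) = l2norm v.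
Proof. by rewrite /l2norm [sqsum (lambda R t v)](sqsum_reindex v (mulg_bij t)). Qed.

Lemma l2norm_rho t v : l2norm (rho R t v) = l2norm v.
Proof.
have b : bijective (fun s => (s * t)%g).
  by exists (fun s => (s * t^-1)%g) => s; rewrite -mulgA ?mulgV ?mulVg mulg1.
by rewrite /l2norm [sqsum (rho R t v)](sqsum_reindex v b).
Qed.

Lemma l2norm_conjJ v : l2norm (conjJ v) = l2norm v.
Proof.
rewrite /l2norm; congr (Num.sqrt (fine _)).
rewrite -(sqsum_reindex v (@invg_bij G)); apply: eq_esum => t _ /=.
by rewrite cabsJ.
Qed.

Lemma conjJK : involutive (@conjJ R G).
Proof. by move=> v; apply: ell2_eqP => s /=; rewrite conjcK invgK. Qed.

Lemma conjJ_lambda t v : conjJ (lambda R t v) = rho R t (conjJ v).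
Proof. by apply: ell2_eqP => s /=; rewrite invgM. Qed.

Lemma conjJ_rho t v : conjJ (rho R t v) = lambda R t (conjJ v).
Proof. by rewrite -{1}[v]conjJK -conjJ_lambda conjJK. Qed.

Lemma group_vN_lambda t : group_vN (lambda R t).
Proof. by move=> A cA; rewrite cA//; exists t. Qed.

Lemma rho_commutant t : commutant (range (@lambda R G)) (rho R t).
Proof. by move=> _ [s _ <-]; rewrite lambda_rho. Qed.

Lemma group_vN_rho x t : group_vN x -> x * rho R t = rho R t * x.
Proof. by move=> Mx; apply: Mx; exact: rho_commutant. Qed.

Local Notation LGop := (opposite (@group_vN R G) (@conjJ R G)).

Lemma opposite_rho t : LGop (rho R t).
Proof.
exists (lambda R t); first exact: group_vN_lambda.
by move=> v; rewrite conjJ_lambda conjJK.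
Qed.

(** Conjugation by [J] exchanges left and right translations, and elements of the
    algebra commute with the right ones. *)
Lemma opposite_commutant c : LGop c -> commutant (range (@lambda R G)) c.
Proof.
move=> [x Mx cE] _ [t _ <-]; apply: bop_eqP => v.
rewrite !bopME !cE conjJ_lambda -[x (rho R t _)]/((x * rho R t) _).
by rewrite group_vN_rho// bopME conjJ_rho.
Qed.

Lemma conjJ_linear (z : R[i]) v w :
  conjJ (z *: v + w) = z^*%C *: conjJ v + conjJ w.
Proof.
apply: ell2_eqP => s; rewrite -[LHS]/((z * v s^-1%g + w s^-1%g)^*)%C.
by rewrite conjD conjM.
Qed.

Lemma opposite_linear (z : R[i]) A C : LGop A -> LGop C -> LGop (z *: A + C).
Proof.
move=> [x Mx AE] [y My CE]; exists (z^*%C *: x + y).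
  exact: commutant_linear.
move=> v; rewrite bopDE bopZE AE CE -[(_ + y) _]/(z^*%C *: x (conjJ v) + y (conjJ v)).
by rewrite conjJ_linear conjcK.
Qed.

Lemma conjJ0 : conjJ (0 : H) = 0.
Proof. by apply: ell2_eqP => s; rewrite -[LHS]/((0 : R[i])^*)%C conjc0. Qed.

Lemma opposite0 : LGop 0.
Proof.
exists 0; first exact: commutant0.
by move=> v; rewrite -[RHS]/(conjJ (0 : H)) conjJ0.
Qed.

(** An operator commuting with the right translations is determined by its first
    column, of which its other columns are translates; its rows are conjugates of
    translates of it. Hence the norm of the first column bounds all columns and
    rows. *)
Lemma column_vN x s : group_vN x -> l2norm (x (delta R s)) = l2norm (x delta1).
Proof.
move=> Mx; have -> : delta R s = rho R s^-1%g delta1.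
  by rewrite rho_delta invgK mul1g.
by rewrite -bopME group_vN_rho// bopME l2norm_rho.
Qed.

Lemma row_vN x w s : group_vN x -> cabs (x w s) <= l2norm (x delta1) * l2norm w.
Proof.
move=> Mx; rewrite (@coordinate_dot _ _ x s (rho R s^-1%g (conjJ (x delta1)))).
  by rewrite (le_trans (cauchy_schwarz _ _))// l2norm_rho l2norm_conjJ mulrC.
move=> t; rewrite rhoE /= conjcK.
have -> : delta R t = rho R t^-1%g delta1 by rewrite rho_delta invgK mul1g.
by rewrite -[LHS]/((x * rho R _) _ _) group_vN_rho// bopME rhoE invgM invgK.
Qed.

Lemma column_commutant c s : commutant (range (@lambda R G)) c ->
  l2norm (c (delta R s)) = l2norm (c delta1).
Proof.
move=> cL; have -> : delta R s = lambda R s delta1 by rewrite lambda_delta mulg1.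
by rewrite -bopME cL; [rewrite bopME l2norm_lambda | exists s].
Qed.

Lemma row_commutant c w s : commutant (range (@lambda R G)) c ->
  cabs (c w s) <= l2norm (c delta1) * l2norm w.
Proof.
move=> cL; rewrite (@coordinate_dot _ _ c s (lambda R s (conjJ (c delta1)))).
  by rewrite (le_trans (cauchy_schwarz _ _))// l2norm_lambda l2norm_conjJ mulrC.
move=> t; rewrite lambdaE /= conjcK.
have -> : delta R t = lambda R t delta1 by rewrite lambda_delta mulg1.
rewrite -[LHS]/((c * lambda R _) _ _) cL; last by exists t.
by rewrite bopME lambdaE invgM invgK.
Qed.

Lemma opnorm_lambda t : opnorm (lambda R t) <= 1.
Proof. by apply: opnorm_le => v; rewrite l2norm_lambda. Qed.

Local Notation ninfty1 := (norm_infty1 (@group_vN R G) delta1).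

(** Both suprema are finite: the pairing with the trace vector is at most the
    2-norm, and an operator is bounded in that norm. *)
Lemma norm_infty1_ge K x y : group_vN x -> opnorm x <= 1 ->
  group_vN y -> opnorm y <= 1 -> cabs (y (K (x delta1)) 1%g) <= ninfty1 K.
Proof.
move=> Mx x1 My y1.
have bound y' v : opnorm y' <= 1 -> cabs (dot (y' v) delta1) <= l2norm v.
  move=> y'1; rewrite dot_delta (le_trans (cabs_le_l2norm _ _))//.
  exact: opnorm_contraction.
have n1 v : norm1 (@group_vN R G) delta1 v <= l2norm v.
  apply: ge_sup.
    by exists (cabs (dot (0 v) delta1)), 0 => //; split; [exact: commutant0|
      apply: opnorm_le => w _; rewrite -[(0 : B) w]/(0 : H) l2norm0].
  by move=> _ [y' [_ y'1] <-]; exact: bound.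
apply: (@le_trans _ _ (norm1 (@group_vN R G) delta1 (K (x delta1)))).
  apply: ub_le_sup; last by exists y => //; rewrite dot_delta.
  by exists (l2norm (K (x delta1))) => _ [y' [_ y'1] <-]; exact: bound.
apply: ub_le_sup; last by exists x.
exists (opnorm K) => _ [x' [_ x'1] <-]; apply: (le_trans (n1 _)).
apply: opnorm_ball; rewrite -(l2norm_delta R (1%g : G)).
exact: opnorm_contraction.
Qed.

Lemma norm_infty1_le K (e : R) :
  (forall x y, group_vN x -> opnorm x <= 1 -> group_vN y -> opnorm y <= 1 ->
    cabs (y (K (x delta1)) 1%g) <= e) -> ninfty1 K <= e.
Proof.
have M0 : group_vN (0 : B) /\ opnorm (0 : B) <= 1.
  split; first exact: commutant0.
  by apply: opnorm_le => w _; rewrite -[(0 : B) w]/(0 : H) l2norm0.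
move=> Ke; apply: ge_sup.
  by exists (norm1 (@group_vN R G) delta1 (K ((0 : B) delta1))), 0.
move=> _ [x [Mx x1] <-]; apply: ge_sup.
  by exists (cabs (dot ((0 : B) (K (x delta1))) delta1)), 0.
by move=> _ [y [My y1] <-]; rewrite dot_delta; exact: Ke.
Qed.

(** Truncating the first column of [x] to a finite set gives the first column of
    a finite combination of left translations, and equally of right ones. *)
Lemma lambda_approx x (e : R) : 0 < e -> exists r : seq G,
  l2norm ((x - \sum_(t <- r) x delta1 t *: lambda R t) delta1) < e.
Proof.
move=> e0; have [r hr] := trunc_approx (x delta1) e0; exists r.
rewrite bopBE bop_sumE (eq_bigr (fun t => x delta1 t *: delta R t))// => t _.
by rewrite bopZE lambda_delta mulg1.
Qed.

Lemma rho_approx x (e : R) : 0 < e -> exists r : seq G,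
  l2norm ((x - \sum_(t <- r) x delta1 t *: rho R t^-1%g) delta1) < e.
Proof.
move=> e0; have [r hr] := trunc_approx (x delta1) e0; exists r.
rewrite bopBE bop_sumE (eq_bigr (fun t => x delta1 t *: delta R t))// => t _.
by rewrite bopZE rho_delta invgK mul1g.
Qed.

End GroupOperators.

(** * Closed ideals of bounded functions and states *)

Section IdealsOfLinfty.
Variables (R : realType) (G : groupType).
Local Notation Linfty := (linf R G).
Variable I : set Linfty.
Hypothesis I_ideal : closed_ideal I.
Implicit Types (f g h : Linfty) (t s : G).

Lemma idealZ (a : R[i]) f : I f -> I (a *: f).
Proof.
move=> If; have -> : a *: f = (a *: (1 : Linfty) : Linfty) * f.
  by apply: linf_eqP => t; rewrite linfME !linfZE mulr1.
exact: idealM.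
Qed.

Lemma ideal_linear (a : R[i]) f g : I f -> I g -> I (a *: f + g).
Proof. by move=> If Ig; apply: idealD => //; exact: idealZ. Qed.

Lemma ideal_approx f : (forall e : R, 0 < e ->
  exists2 g, I g & forall t, cabs (f t - g t) <= e) -> I f.
Proof.
move=> fI; apply: (ideal_closed I_ideal) => e e0.
have [g Ig fg] := fI _ (divr_gt0 e0 (ltr0Sn _ 1)); exists g => //.
apply: (@le_lt_trans _ _ (e / 2)); last by rewrite ltr_pdivrMr// ltr_pMr// ltrDl.
apply: ge_sup; first by exists (cabs ((f - g) 1%g)), 1%g.
by move=> _ [t _ <-]; exact: fg.
Qed.

(** The conjugate of [f] is the product of [f] with a function of modulus at
    most one. *)
Lemma ideal_conj f g : I f -> (forall t, g t = (f t)^*%C) -> I g.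
Proof.
move=> If gf; have [|u uE] := @bounded_linf R G (fun t => (f t)^*%C / f t) 1.
  move=> t; rewrite cabsM cabsJ; have [->|fn0] := eqVneq (f t) 0.
    by rewrite cabs0 mul0r ler01.
  by rewrite -[cabs (f t)]cabsJ -cabsM cabsM cabsJ -cabsM divff// cabs1.
have -> : g = u * f; last exact: idealM.
apply: linf_eqP => t; rewrite gf linfME uE.
have [->|fn0] := eqVneq (f t) 0; first by rewrite conjc0 mulr0.
by rewrite mulfVK.
Qed.

Lemma Rtr_linear t (a : R[i]) f g : Rtr t (a *: f + g) = a *: Rtr t f + Rtr t g.
Proof. exact: linf_eqP. Qed.

Lemma S_group_linear (a : R[i]) f g :
  S_group I f -> S_group I g -> S_group I (a *: f + g).
Proof.
move=> Sf Sg t; rewrite Rtr_linear.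
have -> : a *: f + g - (a *: Rtr t f + Rtr t g) =
    a *: (f - Rtr t f) + (g - Rtr t g).
  by rewrite scalerBr opprD addrACA.
exact: ideal_linear.
Qed.

Lemma S_group1 : S_group I 1.
Proof.
move=> t; rewrite (_ : 1 - Rtr t 1 = 0); first exact: ideal0.
by apply/eqP; rewrite subr_eq0; apply/eqP; exact: linf_eqP.
Qed.

Lemma S_group0 : S_group I 0.
Proof. by rewrite -(subrr 1) addrC -scaleN1r; apply: S_group_linear; exact: S_group1. Qed.

Lemma S_groupZ (a : R[i]) f : S_group I f -> S_group I (a *: f).
Proof. by move=> Sf; rewrite -[_ *: _]addr0; apply: S_group_linear => //; exact: S_group0. Qed.

Lemma S_group_approx f : (forall e : R, 0 < e ->
  exists2 g, S_group I g & forall t, cabs (f t - g t) <= e) -> S_group I f.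
Proof.
move=> fS t; apply: ideal_approx => e e0.
have [g Sg fg] := fS _ (divr_gt0 e0 (ltr0Sn _ 1)); exists (g - Rtr t g) => // s.
have -> : (f - Rtr t f) s - (g - Rtr t g) s = (f s - g s) - (f (s * t)%g - g (s * t)%g).
  by rewrite !(linfDE, linfNE) /=; ring.
apply: le_trans (ler_cabsD _ _) _; rewrite cabsN.
by apply: le_trans (lerD (fg s) (fg _)) _; rewrite -splitr.
Qed.

(** The two inequalities force [z] to be real. *)
Lemma cabs_between (z : R[i]) (c : R) : 0 <= - z + c%:C -> 0 <= z + c%:C ->
  cabs z <= c.
Proof.
case: z => x y; rewrite !lecE => h1 h2.
have [y0 [h3 h4]] : y = 0 /\ (x <= c /\ - x <= c).
  by move: h1 h2 => /= /andP[/eqP h1 h2] /andP[_ h3]; split; [|split]; lra.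
rewrite y0 -[x +i* 0]/(x%:C) cabsR; apply/ler_normlP; split; lra.
Qed.

Section States.
Variable phi : Linfty -> R[i].
Hypothesis phi_state : state_on (S_group I) 1 [set f | forall t, 0 <= f t] phi.

Lemma state_linear (a : R[i]) f g : S_group I f -> S_group I g ->
  phi (a *: f + g) = a * phi f + phi g.
Proof. by case: phi_state => + _ _; apply. Qed.

Lemma state1 : phi 1 = 1. Proof. by case: phi_state. Qed.

Lemma state0 : phi 0 = 0.
Proof.
have := state_linear (-1) S_group1 S_group1.
by rewrite scaleN1r addNr mulN1r addNr.
Qed.

Lemma stateZ (a : R[i]) f : S_group I f -> phi (a *: f) = a * phi f.
Proof.
by move=> Sf; rewrite -[a *: f]addr0 state_linear ?state0 ?addr0//; exact: S_group0.
Qed.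

Lemma state_real_bounded f (c : R) : S_group I f ->
  (forall t, f t = (complex.Re (f t))%:C) ->
  (forall t, cabs (f t) <= c) -> cabs (phi f) <= c.
Proof.
move=> Sf fR fc; have pos (a : R) : a ^+ 2 = 1 -> 0 <= a%:C * phi f + c%:C.
  have S1 : S_group I (c%:C *: (1 : Linfty)) by apply: S_groupZ; exact: S_group1.
  move=> a1.
  have -> : a%:C * phi f + c%:C = phi (a%:C *: f + c%:C *: (1 : Linfty)).
    by rewrite state_linear// (stateZ _ S_group1) state1 mulr1.
  case: phi_state => _ _; apply.
    by apply: S_group_linear => //; apply: S_groupZ; exact: S_group1.
  move=> t; rewrite linfDE !linfZE mulr1 (fR t) -rmorphM -rmorphD /= lecR.
  have := fc t; rewrite (fR t) cabsR => /ler_normlP[].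
  have : (a - 1) * (a + 1) = 0 by rewrite -subr_sqr a1 expr1n subrr.
  move=> /eqP; rewrite mulf_eq0 subr_eq0 addr_eq0 => /orP[] /eqP->; lra.
have := pos 1 (expr1n _ _); have := pos (-1); rewrite sqrrN expr1n => /(_ erefl).
rewrite mul1r rmorphN mulN1r => h1 h2; exact: cabs_between.
Qed.

(** The operator system is stable under conjugation, so it contains the real and
    imaginary parts of [f]; positivity bounds the state on each of them, whence
    the factor 2. *)
Lemma state_bounded f (c : R) : S_group I f -> (forall t, cabs (f t) <= c) ->
  cabs (phi f) <= 2 * c.
Proof.
move=> Sf fc; have [|fJ fJE] := @bounded_linf R G (fun t => (f t)^*%C) c.
  by move=> t; rewrite cabsJ.
have SfJ : S_group I fJ.
  move=> t; apply: ideal_conj (Sf t) _ => s.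
  by rewrite !(linfDE, linfNE) /= !fJE conjD conjN.
(* the real part and the imaginary part of [f] *)
pose h1 := 2^-1 *: (1 *: f + fJ); pose h2 := (0 -i* 2^-1) *: ((-1) *: fJ + f).
have Sh1 : S_group I h1 by apply: S_groupZ; exact: S_group_linear.
have Sh2 : S_group I h2 by apply: S_groupZ; exact: S_group_linear.
have h1E t : h1 t = (complex.Re (f t))%:C.
  rewrite !(linfZE, linfDE) fJE mul1r ReJ_add; exact: mulrC.
have h2E t : h2 t = (complex.Im (f t))%:C.
  rewrite !(linfZE, linfDE) fJE; case: (f t) => x y.
  apply/eqP; rewrite eq_complex /=.
  by apply/andP; split; apply/eqP; field.
have -> : phi f = phi ('i%C *: h2 + h1).
  congr phi; apply: linf_eqP => t; rewrite linfDE linfZE h1E h2E addrC.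
  exact: complexE.
rewrite state_linear//; apply: le_trans (ler_cabsD _ _) _.
have -> : 2 * c = c + c by rewrite mulr_natl.
rewrite cabsM; have -> : cabs 'i%C = 1 :> R.
  by rewrite /cabs /= expr0n expr1n add0r sqrtr1.
rewrite mul1r; apply: lerD; apply: state_real_bounded => // t.
- by rewrite h2E.
- by rewrite h2E cabsR (le_trans (Im_le_cabs _)).
- by rewrite h1E.
- by rewrite h1E cabsR (le_trans (Re_le_cabs _)).
Qed.

End States.

End IdealsOfLinfty.

(** * From invariant states to central states *)

Section Transfer.
Variables (R : realType) (G : groupType).
Local Notation H := (ell2 R G).
Local Notation B := (bop R G).
Local Notation Linfty := (linf R G).
Local Notation M := (@group_vN R G).
Local Notation delta1 := (delta R (1%g : G)).
Local Notation ninfty1 := (norm_infty1 M delta1).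
Local Notation LGop := (opposite M (@conjJ R G)).
Local Notation S_LG := (S_vN M delta1 (@conjJ R G)).
Implicit Types (f g : Linfty) (A C K x y a c : B) (t s r u : G).

(** Translations on both sides are allowed because centrality multiplies by left
    translations on either side, while the operator system of [I] compares a
    diagonal with its right translates. *)
Definition translates_in (I : set Linfty) (X : set B) :=
  forall K t r s, X K ->
    I (diag (lambda R t * K * lambda R r * rho R s)).

(** A matrix entry of [K] in the basis of translations is a value of the
    functionals defining the norm. *)
Lemma diag_translate_le K t r s u :
  cabs (diag (lambda R t * K * lambda R r * rho R s) u) <= ninfty1 K.
Proof.
have -> : diag (lambda R t * K * lambda R r * rho R s) u =
    (lambda R (u^-1 * t)%g) (K (lambda R (r * (u * s^-1))%g delta1)) 1%g.
  rewrite diagE !bopME rho_delta !lambda_delta mulg1.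
  by rewrite !lambdaE mulg1 invgM invgK.
by apply: norm_infty1_ge; (exact: group_vN_lambda || exact: opnorm_lambda).
Qed.

Lemma translates_in_closure (I : set Linfty) X : closed_ideal I ->
  translates_in I X -> translates_in I (K_infty1 M delta1 X).
Proof.
move=> I_ideal IX K t r s KX; apply: ideal_approx => // e /KX[K' XK' KK'].
exists (diag (lambda R t * K' * lambda R r * rho R s)); first exact: IX.
move=> u; apply: le_trans (ltW KK').
apply: le_trans (diag_translate_le (K - K') t r s u).
by rewrite mulrBr !mulrBl.
Qed.

(** Conjugating by [rho s] translates the diagonal by [s] on the right and
    commutes with left translations, so the difference of the two diagonals is
    the diagonal of a commutator with [rho s] multiplied by translations. *)
Lemma diag_S_group (I : set Linfty) X A t r : closed_ideal I ->
  translates_in I X -> S_LG X A ->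
  S_group I (diag (lambda R t * A * lambda R r)).
Proof.
move=> I_ideal IX SA s.
have := translates_in_closure I_ideal IX t r s^-1%g (SA _ (opposite_rho R s)).
congr I; apply: linf_eqP => u.
rewrite -[RHS]/(diag (lambda R t * A * lambda R r) u -
  diag (lambda R t * A * lambda R r) (u * s)%g) !diagE /commutator !(mulrBr, mulrBl) bopBE.
rewrite -[LHS]/((lambda R t * (A * rho R s) * lambda R r * rho R s^-1%g) (delta R u) u
  - (lambda R t * (rho R s * A) * lambda R r * rho R s^-1%g) (delta R u) u).
congr (_ - _).
  rewrite -!mulrA (mulrA (rho R s)) -lambda_rho -mulrA rhoM mulgV rho1 mulr1.
  by [].
rewrite mulrA lambda_rho -!mulrA bopME rhoE !bopME rho_delta invgK.
by [].
Qed.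

(** Right translations permute the basis transitively and commute with [x]. *)
Lemma diag_vN x : M x -> diag x = x delta1 1%g *: (1 : Linfty).
Proof.
move=> Mx; apply: linf_eqP => t; rewrite linfZE mulr1 diagE.
have {1}-> : delta R t = rho R t^-1%g delta1 by rewrite rho_delta invgK mul1g.
by rewrite -[LHS]/((x * rho R _) _ _) group_vN_rho// bopME rhoE mulgV.
Qed.

Lemma diag_left_le x A u : M x ->
  cabs (diag (x * A) u) <= opnorm A * l2norm (x delta1).
Proof.
move=> Mx; rewrite diagE bopME (le_trans (row_vN _ _ Mx))// mulrC.
rewrite ler_wpM2r ?l2norm_ge0// opnorm_ball// l2norm_delta//.
Qed.

Lemma diag_right_le x A u : M x ->
  cabs (diag (A * x) u) <= opnorm A * l2norm (x delta1).
Proof.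
move=> Mx; rewrite diagE bopME (le_trans (cabs_le_l2norm _ _))//.
by rewrite (le_trans (opnormP _ _))// column_vN.
Qed.

Section Centrality.
Variables (I : set Linfty) (X : set B) (phi : Linfty -> R[i]).
Hypothesis I_ideal : closed_ideal I.
Hypothesis IX : translates_in I X.
Hypothesis phi_state : state_on (S_group I) 1 [set f | forall t, 0 <= f t] phi.
Hypothesis phi_inv : forall t f, S_group I f -> phi (Ltr t f) = phi f.

(** Membership is asked of the two diagonals, in the operator system of [I] on
    which [phi] is linear, so that the condition is linear in [x]. *)
Let balanced A x := [/\ S_group I (diag (x * A)), S_group I (diag (A * x)) &
  phi (diag (x * A)) = phi (diag (A * x))].

Let balanced_lambda A t : S_LG X A -> balanced A (lambda R t).
Proof.
move=> SA; have S1 := diag_S_group t 1%g I_ideal IX SA.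
have S2 := diag_S_group 1%g t I_ideal IX SA.
rewrite lambda1 mulr1 in S1; rewrite lambda1 mul1r in S2.
split => //; rewrite -[RHS](phi_inv t)//; congr phi; apply: linf_eqP => u.
rewrite -[RHS]/(diag (A * lambda R t) (t^-1 * u)%g) !diagE !bopME lambdaE.
by rewrite lambda_delta mulgA mulgV mul1g.
Qed.

Let balanced_linear A (z : R[i]) x y :
  balanced A x -> balanced A y -> balanced A (z *: x + y).
Proof.
move=> [x1 x2 xE] [y1 y2 yE].
rewrite /balanced mulrDl mulrDr mulbZl mulbZr !diag_linear.
split; try exact: S_group_linear.
by rewrite !(state_linear phi_state)// xE yE.
Qed.

Let balanced0 A : balanced A 0.
Proof.
rewrite /balanced mul0r mulr0.
by have -> : diag (0 : B) = 0; [exact: linf_eqP | split => //; exact: S_group0].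
Qed.

(** Invariance under left translations is centrality for the unitaries of the
    group; finite combinations of these approximate [x] in the norm of the first
    column, which controls the diagonals of [x * A] and [A * x]. *)
Lemma diag_central x A : M x -> S_LG X A ->
  phi (diag (x * A)) = phi (diag (A * x)).
Proof.
move=> Mx SA; have k0 : 0 < opnorm A + 1 by rewrite ltr_wpDl ?opnorm_ge0.
have approx (e : R) : 0 < e -> exists p, [/\ balanced A p,
    forall u, cabs (diag ((x - p) * A) u) <= e &
    forall u, cabs (diag (A * (x - p)) u) <= e].
  move=> e0; have [l hl] := lambda_approx x (divr_gt0 e0 k0).
  set p := \sum_(t <- l) _ in hl; exists p.
  have Mxp : M (x - p).
    apply: commutantB => //; apply: commutant_sum => t; apply: commutantZ.
    exact: group_vN_lambda.
  have small : opnorm A * l2norm ((x - p) delta1) <= e.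
    move: hl; rewrite ltr_pdivlMr// mulrC => /ltW; apply: le_trans.
    by rewrite ler_wpM2r ?l2norm_ge0// lerDl.
  split.
  - rewrite /p; elim: l {hl p Mxp small} => [|t l IH].
      by rewrite big_nil; exact: balanced0.
    by rewrite big_cons; apply: balanced_linear => //; exact: balanced_lambda.
  - by move=> u; apply: le_trans small; exact: diag_left_le.
  - by move=> u; apply: le_trans small; exact: diag_right_le.
have diagB C C' u : diag (C - C') u = diag C u - diag C' u by [].
have Sl : S_group I (diag (x * A)).
  apply: S_group_approx => // e /approx[p [[Sp _ _] h _]].
  by exists (diag (p * A)) => // u; rewrite -diagB -mulrBl.
have Sr : S_group I (diag (A * x)).
  apply: S_group_approx => // e /approx[p [[_ Sp _] _ h]].
  by exists (diag (A * p)) => // u; rewrite -diagB -mulrBr.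
apply/eqP; rewrite -subr_eq0; apply/eqP/cabs_eq0/eqP.
rewrite eq_le cabs_ge0 andbT; apply/ler_addgt0Pr => e e0; rewrite add0r.
have [p [[Sp1 Sp2 pE] h1 h2]] := approx _ (divr_gt0 e0 (ltr0Sn _ 3)).
have E1 : diag ((x - p) * A) = (-1) *: diag (p * A) + diag (x * A).
  by rewrite mulrBl addrC -scaleN1r diag_linear.
have E2 : diag (A * (x - p)) = (-1) *: diag (A * p) + diag (A * x).
  by rewrite mulrBr addrC -scaleN1r diag_linear.
have -> : phi (diag (x * A)) - phi (diag (A * x)) =
    phi (diag ((x - p) * A)) - phi (diag (A * (x - p))).
  by rewrite E1 E2 !(state_linear phi_state)// pE opprD addrACA subrr add0r.
apply: (le_trans (ler_cabsD _ _)); rewrite cabsN.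
have b1 : cabs (phi (diag ((x - p) * A))) <= 2 * (e / 4).
  by apply: (state_bounded I_ideal phi_state) => //; rewrite E1; exact: S_group_linear.
have b2 : cabs (phi (diag (A * (x - p)))) <= 2 * (e / 4).
  by apply: (state_bounded I_ideal phi_state) => //; rewrite E2; exact: S_group_linear.
by move: b1 b2; lra.
Qed.

End Centrality.

(** By contraposition: the state [phi \o diag] is central, and on the algebra it
    is the vector state of the trace vector, hence normal. *)
Lemma group_pp_of_LG_pp (I : set Linfty) X : closed_ideal I ->
  translates_in I X -> LG_properly_proximal X -> group_properly_proximal I.
Proof.
move=> I_ideal IX LGpp [phi [st inv]]; apply: LGpp; exists (phi \o @diag R G).
have S_diag A : S_LG X A -> S_group I (diag A).
  move=> /(diag_S_group 1%g 1%g I_ideal IX).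
  by rewrite lambda1 mul1r mulr1.
split.
- split.
  + move=> a A C /S_diag SA /S_diag SC.
    by rewrite /= diag_linear (state_linear st).
  + rewrite /= -(state1 st); congr phi; apply: linf_eqP => t.
    by rewrite diagE /= /delta_fun eqxx.
  + move=> A /S_diag SA Apos; case: st => _ _; apply => // t.
    by rewrite diagE -dot_delta; exact: Apos.
- by move=> x A Mx SA; exact: (diag_central I_ideal IX).
- rewrite /normal; apply: (@subspace_eq_continuous (ultraweak R G) M R[i]^o
    (fun A : B => dot (A delta1) delta1)).
    move=> x; rewrite inE => Mx /=.
    rewrite -[RHS]/(phi (diag (x : B))) diag_vN// (stateZ I_ideal st); last exact: S_group1.
    by rewrite (state1 st) mulr1 dot_delta.
  apply: continuous_subspaceT; exact: vector_functional_continuous.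
Qed.

End Transfer.

(** * Boundary pieces, and from central states to invariant states *)

Section Pieces.
Variables (R : realType) (G : groupType).
Local Notation H := (ell2 R G).
Local Notation B := (bop R G).
Local Notation Linfty := (linf R G).
Local Notation M := (@group_vN R G).
Local Notation delta1 := (delta R (1%g : G)).
Local Notation ninfty1 := (norm_infty1 M delta1).
Local Notation LGop := (opposite M (@conjJ R G)).
Local Notation S_LG := (S_vN M delta1 (@conjJ R G)).
Implicit Types (f g : Linfty) (A C K x y a c : B) (t s r u : G).

Lemma ideal_of_piece_closed (X : set B) : closed_ideal (ideal_of_piece X).
Proof.
split.
- by move=> J [J_ideal _]; exact: ideal0.
- by move=> f g If Ig J HJ; apply: (idealD HJ.1); [exact: If | exact: Ig].
- by move=> f g Ig J HJ; apply: (idealM HJ.1); exact: Ig.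
- move=> f If J HJ; apply: (ideal_closed HJ.1) => e e0.
  by have [g Ig fg] := If e e0; exists g => //; exact: Ig.
Qed.

Lemma multiplier_linear (X : set B) (z : R[i]) A C : cstar_subalgebra X ->
  multiplier X A -> multiplier X C -> multiplier X (z *: A + C).
Proof.
move=> Xalg XA XC K XK; have [h1 h2] := XA K XK; have [h3 h4] := XC K XK.
rewrite mulrDl mulrDr mulbZl mulbZr.
by split; apply: (cstarD Xalg) => //; exact: (cstarZ Xalg).
Qed.

Lemma multiplier0 (X : set B) : cstar_subalgebra X -> multiplier X 0.
Proof. by move=> Xalg K XK; rewrite mul0r mulr0; split; exact: (cstar0 Xalg). Qed.

Section BoundaryPiece.
Variable X : set B.
Hypothesis X_piece : LG_boundary_piece X.
Let Xalg := bpiece_cstar X_piece.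
Local Notation I := (ideal_of_piece X).
Let I_ideal := ideal_of_piece_closed X.

Let diag_in K : X K -> I (diag K).
Proof. by move=> XK J [_]; apply; exists K. Qed.

Let lambda_multiplier t (e : R) : 0 < e ->
  exists2 a, (multiplier X `&` M) a & l2norm ((lambda R t - a) delta1) < e.
Proof.
move=> e0; apply: ultraweak_closure_approx => //.
- by split; [exact: multiplier0 | exact: commutant0].
- move=> z A C [A1 A2] [C1 C2].
  by split; [exact: multiplier_linear | exact: commutant_linear].
- by apply: (bpiece_denseM X_piece); exact: group_vN_lambda.
Qed.

Let rho_multiplier t (e : R) : 0 < e ->
  exists2 b, (multiplier X `&` LGop) b & l2norm ((rho R t - b) delta1) < e.
Proof.
move=> e0; apply: ultraweak_closure_approx => //.
- by split; [exact: multiplier0 | exact: opposite0].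
- move=> z A C [A1 A2] [C1 C2].
  by split; [exact: multiplier_linear | exact: opposite_linear].
- by apply: (bpiece_denseJMJ X_piece); exact: opposite_rho.
Qed.

(** The common form of three successive approximations, in which a translation
    [c] is replaced by a multiplier [b] in an operator [P c]. *)
Let approx_diag (P : B -> B) (S : set B) c K :
  (forall b, S b -> I (diag (P b))) ->
  (forall e : R, 0 < e -> exists2 b, S b & l2norm ((c - b) delta1) < e) ->
  (forall b u, S b ->
     cabs (diag (P c) u - diag (P b) u) <= opnorm K * l2norm ((c - b) delta1)) ->
  I (diag (P c)).
Proof.
move=> IP Sc Pc; apply: ideal_approx => // e e0.
have k0 : 0 < opnorm K + 1 by rewrite ltr_wpDl ?opnorm_ge0.
have [b Sb bc] := Sc _ (divr_gt0 e0 k0).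
exists (diag (P b)); first exact: IP.
move=> u; apply: (le_trans (Pc b u Sb)).
move: bc; rewrite ltr_pdivlMr// mulrC => /ltW; apply: le_trans.
by rewrite ler_wpM2r ?l2norm_ge0// lerDl.
Qed.

(** [X] is an ideal for its multipliers but not for the translations; these are
    replaced by multipliers one at a time, starting on the right. The error is
    controlled by a column bound when the factor stands on the right of [K] and by
    a row bound when it stands on the left. *)
Lemma boundary_piece_translates : translates_in I X.
Proof.
have step1 K s : X K -> I (diag (K * rho R s)).
  move=> XK; apply: (@approx_diag (fun b => K * b) (multiplier X `&` LGop) _ K).
  - by move=> b [Xb _]; apply: diag_in; exact: (Xb K XK).2.
  - by move=> e; exact: rho_multiplier.
  move=> b u [_ opb]; rewrite !diagE -[_ - _]/((K * rho R s - K * b) (delta R u) u).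
  rewrite -mulrBr bopME (le_trans (cabs_le_l2norm _ _))// (le_trans (opnormP _ _))//.
  rewrite column_commutant//; apply: opposite_commutant.
  by rewrite addrC -scaleN1r; apply: opposite_linear => //; exact: opposite_rho.
have step2 K r s : X K -> I (diag (K * lambda R r * rho R s)).
  move=> XK; apply: (@approx_diag (fun a => K * a * rho R s) (multiplier X `&` M) _ K).
  - by move=> a [Xa _]; apply: step1; exact: (Xa K XK).2.
  - by move=> e; exact: lambda_multiplier.
  move=> a u [_ Ma].
  rewrite !diagE -[_ - _]/((K * lambda R r * rho R s - K * a * rho R s) (delta R u) u).
  rewrite -mulrBl -mulrBr !bopME (le_trans (cabs_le_l2norm _ _))//.
  rewrite (le_trans (opnormP _ _))// rho_delta column_vN//.
  by apply: commutantB => //; exact: group_vN_lambda.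
move=> K t r s XK.
apply: (@approx_diag (fun a => a * K * lambda R r * rho R s) (multiplier X `&` M) _ K).
- by move=> a [Xa _]; apply: step2; exact: (Xa K XK).1.
- by move=> e; exact: lambda_multiplier.
move=> a u [_ Ma].
rewrite !diagE -[_ - _]/((lambda R t * K * lambda R r * rho R s -
  a * K * lambda R r * rho R s) (delta R u) u).
rewrite -!mulrBl !bopME (le_trans (row_vN _ _ _))//.
  by apply: commutantB => //; exact: group_vN_lambda.
rewrite mulrC ler_wpM2r ?l2norm_ge0// opnorm_ball//.
by rewrite l2norm_lambda l2norm_rho l2norm_delta.
Qed.

End BoundaryPiece.

Section PieceOfIdeal.
Variable I : set Linfty.
Hypothesis I_ideal : closed_ideal I.
Hypothesis I_inv : translation_invariant I.

Let I_sum (J : Type) (l : seq J) (F : J -> Linfty) :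
  (forall j, I (F j)) -> I (\sum_(j <- l) F j).
Proof.
move=> IF; elim: l => [|j l IH]; first by rewrite big_nil; exact: ideal0.
by rewrite big_cons; exact: idealD.
Qed.

(** One factor in the ideal is enough: the factor [mulop (f k)] on the left,
    moved through [lambda t], multiplies the diagonal by a translate of [f k]. *)
Lemma piece_of_ideal_translates : translates_in I (piece_of_ideal I).
Proof.
move=> K t r s XK; apply: ideal_approx => // e /XK[_ [n [f [g [C [fg ->]]]]] KK].
set K' := \sum_(k < n) _ in KK.
exists (diag (lambda R t * K' * lambda R r * rho R s)).
  rewrite /K' mulr_sumr !mulr_suml diag_sum; apply: I_sum => k.
  have [If _] := fg k; have [IL _] := I_inv t If.
  set D := diag _.
  have -> : D = diag (lambda R t * C k * mulop (g k) * lambda R r * rho R s) * Ltr t (f k).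
    apply: linf_eqP => u; rewrite linfME mulrC /D !diagE !bopME lambdaE mulopE.
    by [].
  exact: idealM.
move=> u; rewrite !diagE.
rewrite -[_ - _]/((lambda R t * K * lambda R r * rho R s -
  lambda R t * K' * lambda R r * rho R s) (delta R u) u).
rewrite -!mulrBl -mulrBr !bopME (le_trans (cabs_le_l2norm _ _))//.
rewrite l2norm_lambda (le_trans _ (ltW KK))// opnorm_ball//.
by rewrite l2norm_lambda l2norm_rho l2norm_delta.
Qed.

(** A member [g] of a closed ideal is close to [chi * g], with [chi] the indicator
    function of the set where [g] is not small. [chi] is a multiple of [g], hence
    in the ideal, and it can be moved to the other side of the unitary, where it
    becomes one of its translates. *)
Lemma mulop_translate_approx g t s (e : R) : I g -> 0 < e ->
  exists F : Linfty * B * Linfty, [/\ I F.1.1, I F.2 &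
    opnorm (mulop g * (rho R t * lambda R s) - mulop F.1.1 * F.1.2 * mulop F.2) <= e].
Proof.
move=> Ig e0.
have [|chi chiE] := @bounded_linf R G (fun u => (e <= cabs (g u))%R%:R) 1.
  by move=> u; case: (e <= cabs (g u)); rewrite ?cabs1 ?cabs0.
have [|h hE] := @bounded_linf R G (fun u => chi u / g u) e^-1.
  move=> u; rewrite chiE; case: (leP e (cabs (g u))) => eg; last first.
    by rewrite mulr0n mul0r cabs0 invr_ge0 ltW.
  rewrite mulr1n mul1r; have g0 : 0 < cabs (g u) by apply: lt_le_trans eg.
  have gn0 : g u != 0 by apply: contraTneq g0 => ->; rewrite cabs0 ltxx.
  have -> : cabs (g u)^-1 = (cabs (g u))^-1.
    by apply: (mulIf (lt0r_neq0 g0)); rewrite -cabsM !mulVf ?cabs1// lt0r_neq0.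
  by rewrite lef_pV2.
have Ichi : I chi.
  have -> : chi = h * g; last exact: idealM.
  apply: linf_eqP => u; rewrite linfME hE chiE; case: (leP e (cabs (g u))) => eg.
    have gn0 : g u != 0.
      by apply: contraTneq eg => ->; rewrite cabs0 -ltNge.
    by rewrite mulfVK.
  by rewrite mulr0n !mul0r.
pose chi' := Ltr s^-1%g (Rtr t^-1%g chi).
exists (chi, mulop g * (rho R t * lambda R s), chi'); split => //=.
  exact: (I_inv _ (I_inv _ Ichi).2).1.
apply: opnorm_le => v v1; apply: (@le_trans _ _ (e * l2norm (rho R t (lambda R s v)))).
  apply: pointwise_l2norm_le => [|u]; first exact: ltW.
  rewrite bopBE -[X in cabs X]/(mulop g (rho R t (lambda R s v)) u -
    mulop chi (mulop g (rho R t (lambda R s (mulop chi' v)))) u).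
  have chi'E : rho R t (lambda R s (mulop chi' v)) u = chi u * rho R t (lambda R s v) u.
    rewrite !(rhoE, lambdaE, mulopE); congr (_ * _).
    rewrite -[LHS]/(chi (s^-1^-1 * (s^-1 * (u * t)) * t^-1)%g).
    by rewrite mulKg mulgK.
  rewrite !(mulopE _ (rho _ _ _)) (mulopE chi) (mulopE g) chi'E chiE.
  set w := rho R t (lambda R s v) u; case: (leP e (cabs (g u))) => eg.
    by rewrite mulr1n !mul1r subrr cabs0 mulr_ge0 ?cabs_ge0// ltW.
  by rewrite mulr0n mul0r subr0 cabsM ler_wpM2r ?cabs_ge0// ltW.
by rewrite l2norm_rho l2norm_lambda ler_piMr// ltW.
Qed.

(** Right translation acts on functions through conjugation by [rho t]. *)
Lemma commutator_mulop_rho f s t :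
  commutator (mulop f * lambda R s) (rho R t) =
  mulop (f - Rtr t f) * (rho R t * lambda R s).
Proof.
apply: bop_eqP => v; apply: ell2_eqP => u.
rewrite -[LHS]/(f u * v (s^-1 * u * t)%g - f (u * t)%g * v (s^-1 * (u * t))%g).
rewrite -[RHS]/((f u - f (u * t)%g) * v (s^-1 * (u * t))%g).
by rewrite mulgA mulrBl.
Qed.

(** In one term of the commutator [c] moves past [x] and acts on the trace
    vector; in the other it moves past [y] and its first row is evaluated. Hence
    the bound involves [c] through [c delta1] only. *)
Lemma commutator_small A c : LGop c -> forall x y, M x -> opnorm x <= 1 ->
  M y -> opnorm y <= 1 ->
  cabs (y (commutator A c (x delta1)) 1%g) <= 2 * opnorm A * l2norm (c delta1).
Proof.
move=> opc x y Mx x1 My y1; have cL := opposite_commutant opc.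
have xc : x * c = c * x by apply: Mx.
have yc : y * c = c * y by apply: My.
rewrite /commutator bopBE bopB.
rewrite -[_ 1%g]/(y (A (c (x delta1))) 1%g - y (c (A (x delta1))) 1%g).
have -> : c (x delta1) = x (c delta1) by rewrite -!bopME xc.
have -> : y (c (A (x delta1))) = c (y (A (x delta1))) by rewrite -!(bopME y) -bopME yc.
apply: (le_trans (ler_cabsD _ _)); rewrite cabsN -mulrA mulr_natl mulr2n lerD//.
  rewrite (le_trans (cabs_le_l2norm _ _))// (le_trans (opnorm_contraction _ y1))//.
  rewrite (le_trans (opnormP _ _))// ler_wpM2l ?opnorm_ge0//.
  exact: opnorm_contraction.
rewrite (le_trans (row_commutant _ _ cL))// mulrC ler_wpM2r ?l2norm_ge0//.
rewrite (le_trans (opnorm_contraction _ y1))// opnorm_ball//.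
by rewrite (le_trans (opnorm_contraction _ x1))// l2norm_delta.
Qed.

(** The right factor [lambda s] is there for invariance of the state, which needs
    [mulop f * lambda s] in the operator system. The element [c] of the commutant
    is replaced by a combination [p] of right translations; [commutator_small]
    handles the commutator with [c - p], and the commutator with [p] is a finite
    sum of elements of the ideal times unitaries. *)
Lemma mulop_lambda_S f s : S_group I f ->
  S_LG (piece_of_ideal I) (mulop f * lambda R s).
Proof.
move=> Sf c opc e e0; set A := mulop f * lambda R s.
have k0 : 0 < opnorm A + 1 by rewrite ltr_wpDl ?opnorm_ge0.
have [l hl] := rho_approx c (divr_gt0 (divr_gt0 e0 (ltr0Sn _ 3)) k0).
set p := \sum_(t <- l) _ in hl.
have n0 : 0 < (size l).+1%:R :> R by rewrite ltr0n.
have step t : exists F : Linfty * B * Linfty, [/\ I F.1.1, I F.2 &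
    opnorm (c delta1 t *: commutator A (rho R t^-1%g) -
      mulop F.1.1 * F.1.2 * mulop F.2) <= e / 4 / (size l).+1%:R].
  have Ig := idealZ I_ideal (c delta1 t) (Sf t^-1%g).
  have [F [F1 F2 F3]] := mulop_translate_approx t^-1%g s Ig
    (divr_gt0 (divr_gt0 e0 (ltr0Sn _ 3)) n0).
  exists F; split; [exact: F1|exact: F2|].
  by rewrite commutator_mulop_rho -mulbZl -mulopZ.
have /choice[F FP] := step.
pose K := \sum_(t <- l) mulop (F t).1.1 * (F t).1.2 * mulop (F t).2.
exists K.
  move=> e' e'0; exists K; last by rewrite subrr (le_lt_trans (opnorm0 _ _)).
  (* finite sums over [l] are reindexed by positions, as the piece is spanned by
     families indexed by ordinals *)
  exists (size l), (fun k => (F (tnth (in_tuple l) k)).1.1),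
    (fun k => (F (tnth (in_tuple l) k)).2), (fun k => (F (tnth (in_tuple l) k)).1.2).
  split; last by rewrite /K big_tnth.
  by move=> k; have [] := FP (tnth (in_tuple l) k).
have opcp : LGop (c - p).
  rewrite addrC -scaleN1r; apply: opposite_linear => //.
  rewrite /p; elim: (l) => [|t l' IH]; first by rewrite big_nil; exact: opposite0.
  by rewrite big_cons; apply: opposite_linear => //; exact: opposite_rho.
have E : commutator A c - K = commutator A (c - p) +
    \sum_(t <- l) (c delta1 t *: commutator A (rho R t^-1%g) -
      mulop (F t).1.1 * (F t).1.2 * mulop (F t).2).
  rewrite sumrB -commutator_sumr -/p -/K addrA; congr (_ - _).
  by rewrite -{1}[c](subrK p) /commutator mulrDr mulrDl opprD addrACA.
apply: (@le_lt_trans _ _ (e / 2 + e / 4)); last by move: e0; lra.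
apply: norm_infty1_le => x y Mx x1 My y1.
rewrite E bopDE bopD -[_ 1%g]/(y (commutator A (c - p) (x delta1)) 1%g +
  y ((\sum_(t <- l) (c delta1 t *: commutator A (rho R t^-1%g) -
      mulop (F t).1.1 * (F t).1.2 * mulop (F t).2)) (x delta1)) 1%g).
apply: (le_trans (ler_cabsD _ _)); apply: lerD.
  apply: (le_trans (commutator_small _ opcp Mx x1 My y1)).
  move: hl; rewrite ltr_pdivlMr// => hl.
  have := opnorm_ge0 A; have := l2norm_ge0 ((c - p) delta1); move: hl.
  set d := l2norm _; set q := opnorm A; nra.
rewrite (le_trans (cabs_le_l2norm _ _))// (le_trans (opnorm_contraction _ y1))//.
rewrite bop_sumE (le_trans (l2norm_sum _ _))//.
apply: (@le_trans _ _ (\sum_(t <- l) (e / 4 / (size l).+1%:R))).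
  apply: ler_sum => t _; have [_ _ hF] := FP t; apply: le_trans hF.
  by rewrite opnorm_ball// (le_trans (opnorm_contraction _ x1))// l2norm_delta.
rewrite big_const_seq count_predT iter_addr_0.
rewrite -[X in X <= _]mulr_natr mulrAC ler_pdivrMr//.
by rewrite ler_wpM2l ?ler_nat// divr_ge0// ltW.
Qed.

(** By contraposition: [phi \o mulop] is invariant because [mulop (Ltr t f)] is
    the conjugate of [mulop f] by the unitary [lambda t] of the algebra, for which
    [phi] is central. *)
Lemma LG_pp_of_group_pp : group_properly_proximal I ->
  LG_properly_proximal (piece_of_ideal I).
Proof.
move=> Gpp [phi [[lin one pos] central _]]; apply: Gpp.
have S_mulop f : S_group I f ->
    S_LG (piece_of_ideal I) (mulop f).
  by move=> /(mulop_lambda_S 1%g); rewrite lambda1 mulr1.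
exists (fun f => phi (mulop f)); split; first split.
- move=> a f g Sf Sg.
  rewrite (mulop_linear a f g).
  exact: lin a _ _ (S_mulop f Sf) (S_mulop g Sg).
- rewrite -one; congr phi; apply: bop_eqP => v; apply: ell2_eqP => t.
  by rewrite mulopE mul1r.
- by move=> f /S_mulop Sf f0; apply: pos => //; exact: mulop_positive.
move=> t f Sf.
have -> : mulop (Ltr t f) = lambda R t * (mulop f * lambda R t^-1%g).
  apply: bop_eqP => v; apply: ell2_eqP => u.
  rewrite !bopME lambdaE !mulopE lambdaE invgK mulgA mulgV mul1g.
  by [].
rewrite central; [|exact: group_vN_lambda|exact: mulop_lambda_S].
by rewrite -mulrA lambdaM mulVg lambda1 mulr1.
Qed.

End PieceOfIdeal.
End Pieces.

Theorem theorem6p4 (R : realType) (G : groupType)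
    (I : set (linf R G)) (X : set (bop R G))
    (I_ideal : closed_ideal I) (I_inv : translation_invariant I)
    (c0_I : (@c_0 R G `<=` I)%classic) (I_proper : I <> setT)
    (X_piece : LG_boundary_piece X) :
  (LG_properly_proximal X ->
     group_properly_proximal (ideal_of_piece X)) /\
  (group_properly_proximal I <-> LG_properly_proximal (piece_of_ideal I)).
Proof.
split.
  apply: group_pp_of_LG_pp; first exact: ideal_of_piece_closed.
  exact: boundary_piece_translates.
split; first exact: LG_pp_of_group_pp.
by apply: group_pp_of_LG_pp => //; exact: piece_of_ideal_translates.
Qed.
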